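(* Let $T(z)$ be the exponential generating function associated with the labeled class $3\mathrm{LP}_{\bullet}$ specified by \begin{align*} 3\mathrm{LP}_{\bullet} &= \mathcal{L}_{\bullet}\times(\mathcal{S}_C+\mathcal{S}_X)+\mathcal{K}_{\bullet}, & \mathcal{S}_C &= \mathrm{Set}_{\ge 2}(\mathcal{L}+\mathcal{S}_X),\\ \mathcal{S}_X &= \mathcal{L}\times \mathrm{Set}_{\ge 1}(\mathcal{L}+\mathcal{S}_X), & \mathcal{L} &= \mathcal{Z}+\mathrm{Set}_{\ge 2}(\mathcal{Z}),\\ \mathcal{L}_{\bullet} &= \mathcal{Z}_{\bullet}+\mathcal{Z}_{\bullet}\times \mathrm{Set}_{\ge 1}(\mathcal{Z}), & \mathcal{K}_{\bullet} &= \mathcal{Z}_{\bullet}\times \mathrm{Set}_{\ge 2}(\mathcal{Z}). \end{align*} Let $t_n$ be the number of labeled, unrooted, connected $3$-leaf power graphs on $n$ vertices. Then for all $n\ge 3$, $$t_n=(n-1)!\,[z^n]\,T(z),$$ and the values $t_1,\dots,t_{12}$ are, in order, $$1,\ 1,\ 4,\ 35,\ 361,\ 4482,\ 68027,\ 1238841,\ 26416474,\ 646139853,\ 17837851021,\ 548713086352.$$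
   Context: All graphs are finite and simple. A graph $G=(V,E)$ is a $3$-leaf power graph if there is a tree $T$ whose set of leaves is $V$ such that, for distinct $x,y\in V$, one has $xy\in E$ iff the distance in $T$ between the leaves $x$ and $y$ is at most $3$ (the one-vertex graph is counted as a $3$-leaf power graph). A labeled graph on $n$ vertices has vertex set $\{1,\dots,n\}$. The class $3\mathrm{LP}_\bullet$ represents, in sizes $n\ge 3$, connected $3$-leaf power graphs with one distinguished vertex. Notation for labeled combinatorial classes (Flajolet–Sedgewick), size being the number of atoms: $\mathcal{Z}$ and $\mathcal{Z}_\bullet$ are atoms of size $1$, each with exponential generating function $z$; $+$ is disjoint union; $\times$ is the labeled product (product of exponential generating functions); $\mathrm{Set}_{\ge k}(\mathcal{A})$ is the class of sets of at least $k$ objects of $\mathcal{A}$, with exponential generating function $\sum_{i\ge k}A(z)^i/i!$. All auxiliary classes have no object of size $0$, and the system determines them uniquely. The exponential generating function of a class with $a_n$ labeled objects of size $n$ is $\sum_n a_n z^n/n!$, and $[z^n]$ denotes coefficient extraction. *)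

(* Defs.v *)
From Stdlib Require Import BinNat.
From HB Require Import structures.
From mathcomp Require Import all_boot all_order all_algebra finmap.
From mathcomp Require Import boolp classical_sets cardinality.

Set Implicit Arguments.
Unset Strict Implicit.
Unset Printing Implicit Defensive.

Import Order.TTheory GRing.Theory Num.Theory.

(* Graphs on a finite type are given by their adjacency relation. *)

Definition connected_graph (V : finType) (e : rel V) : Prop :=
  (0 < #|V|)%N /\ forall x y : V, connect e x y.

(* [ucycle e c] means that c is a closed e-walk without repeated vertices; the
   bound on the size excludes the walk x, y, x along a single edge. *)
Definition acyclic_graph (V : finType) (e : rel V) : Prop :=
  forall c : seq V, ucycle e c -> (size c <= 2)%N.

Definition is_tree (V : finType) (e : rel V) : Prop :=
  [/\ symmetric e, irreflexive e, connected_graph e & acyclic_graph e].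

Definition is_leaf (V : finType) (e : rel V) (x : V) : bool :=
  #|[set y | e x y]| == 1%N.

(* Length of a shortest walk from x to y; it is #|V| if there is none. *)
Definition gdist (V : finType) (e : rel V) (x y : V) : nat :=
  find (fun k => [exists p : k.-tuple V, path e x p && (last x p == y)])
       (iota 0 #|V|).

(* V is identified with the set of leaves of the tree through f.  The
   one-vertex graph counts as a leaf power by convention. *)
Definition leaf_power (k : nat) (V : finType) (e : rel V) : Prop :=
  #|V| = 1%N \/
  exists (W : finType) (t : rel W) (f : V -> W),
    [/\ is_tree t, injective f,
        forall w : W, is_leaf t w <-> exists x : V, w = f x
      & forall x y : V, x != y -> e x y = (gdist t (f x) (f y) <= k)%N].

(* A simple graph on the labels 'I_n (that is, {0, ..., n-1} in place of
   {1, ..., n}) is given by its set of edges. *)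
Definition simple_edges (V : finType) (E : {set {set V}}) : bool :=
  E \subset [set e : {set V} | #|e| == 2%N].

Definition edge_rel (V : finType) (E : {set {set V}}) : rel V :=
  fun x y => [set x; y]%SET \in E.

Definition num_connected_3leaf_power (n : nat) : nat :=
  #|[set E : {set {set 'I_n}} |
      simple_edges E &&
      `[< connected_graph (edge_rel E) /\ leaf_power 3 (edge_rel E) >]]%SET|.

(* Labelled combinatorial classes.  The atoms of an object carry pairwise
   distinct labels, which form an arbitrary finite set of natural numbers;
   the objects counted in size n are the well-labelled ones, whose label set is
   {1, ..., n}.  As all labellings of a structure are in the class, the
   components of a labelled product only need disjoint label sets, and no
   relabelling is involved. *)

Record lclass : Type := LClass {
  obj : choiceType;
  labels : obj -> {fset nat}
}.

Section Constructions.
Local Open Scope fset_scope.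

Definition cl_atom : lclass := @LClass nat (fun i => [fset i]).

Definition cl_sum (A B : lclass) : lclass :=
  @LClass (obj A + obj B)%type
    (fun x => match x with inl a => labels a | inr b => labels b end).

Definition cl_prod (A B : lclass) : lclass :=
  @LClass {x : obj A * obj B | fdisjoint (labels x.1) (labels x.2)}
    (fun x => labels (val x).1 `|` labels (val x).2).

Definition cl_set_ge (k : nat) (A : lclass) : lclass :=
  @LClass {S : {fset obj A} |
      (k <= #|` S|)%N &&
      [forall x : S, forall y : S,
         (x != y) ==> fdisjoint (labels (val x)) (labels (val y))]}
    (fun S => \bigcup_(x <- val S) labels x).

Definition cl_iso (A B : lclass) : Prop :=
  exists f : obj A -> obj B,
    bijective f /\ forall x : obj A, labels (f x) = labels x.

(* [fset_set] sends an infinite set to fset0; this never occurs for a class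
   built from atoms by a specification without objects of size 0. *)
Definition cl_count (A : lclass) (n : nat) : nat :=
  #|` fset_set [set x : obj A | labels x = [fset i in iota 1 n]]%classic|.

End Constructions.

Declare Scope lclass_scope.
Delimit Scope lclass_scope with L.
Bind Scope lclass_scope with lclass.
Notation "''Z'" := cl_atom : lclass_scope.
(* The distinguished atom is a copy of the atom. *)
Notation "''Zp'" := cl_atom : lclass_scope.
Notation "A + B" := (cl_sum A B) : lclass_scope.
Notation "A * B" := (cl_prod A B) : lclass_scope.
Notation "'Set_ge' k A" := (cl_set_ge k A)
  (at level 10, k at level 9, A at level 9) : lclass_scope.
Notation "A ~= B" := (cl_iso A B) (at level 70) : lclass_scope.

(* A formal power series is given by its sequence of coefficients. *)
Definition egf (A : lclass) : nat -> rat :=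
  fun n => ((cl_count A n)%:R / (n`!)%:R)%R.

(* Main.v *)
Require Import Defs.
From Stdlib Require Import BinNat.
From mathcomp Require Import all_boot all_order all_algebra finmap.
From mathcomp Require Import boolp.

(** A connected graph is a 3-leaf power exactly when it is a blow-up of a tree:
    each node of a tree is replaced by a nonempty clique, a block, and
    adjacent nodes by completely joined blocks.  Given a leaf root, the nodes
    are the neighbours of its leaves, the block of a node being the set of
    leaves attached to it, because two leaves are at distance at most 3 exactly
    when their neighbours are equal or adjacent.

    Both sides are counted by one sequence.  Let f(n), [forest_num], be the
    number of forests of rooted blow-ups on n labels, and let
    a(n) = sum_(i < n) C(n, i) f(i), [rooted_num], be the number of rooted
    blow-up trees: the root block is the complement of a proper subset that
    carries the forest of its children.  Splitting off the tree that contains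
    a fixed label gives f(n+1) = sum_(j <= n) C(n, j) a(j+1) f(n-j).

    A rooted blow-up tree is not determined by its underlying graph, since a
    complete graph is a blow-up of a tree with one or with two nodes.  It is
    determined by the graph together with the root block, and for forests by
    the graph together with the union of the root blocks
    ([counted_blowup_forest]).  If the graph is connected and not complete,
    then the block of a vertex r is recovered as its class of true twins
    ([blowup_tree_block_uniq]).  Rooting at the block of a fixed vertex, and
    discarding for each block the one tree whose graph is complete, gives
      t_n = 1 + sum_(j < n) C(n-1, j) (f(j) - 1),
    which is [graph_num].

    On the side of the specification, the objects of L + SX with a label set
    of size n are counted by a(n), and the sets of such objects with disjoint
    labels by f(n) ([counted_label_partition]).  An object of SX being read as
    a singleton, SC + SX leaves out of these sets the empty one and the
    singletons of an object of L, that is one set for each label set; hence 3LP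
    has n t_n objects of size n for n >= 3 ([counted_LP]).

    The equivalence between 3-leaf powers and blow-ups ([leaf_power_tree],
    [tree_leaf_power]) represents a rooted tree by a parent map whose rank
    decreases along the parents. *)

Set Implicit Arguments.
Unset Strict Implicit.
Unset Printing Implicit Defensive.

(** * Enumerations *)

(** [counted P m]: exactly m elements satisfy P.  A duplicate-free list is used
    rather than a cardinal so that infinite types are covered as well. *)
Definition counted (T : eqType) (P : T -> Prop) (m : nat) : Prop :=
  exists s : seq T, [/\ uniq s, forall x, (x \in s) <-> P x & size s = m].

Section Counted.
Implicit Types T U : eqType.

Lemma counted_ext T (P Q : T -> Prop) m :
  (forall x, P x <-> Q x) -> counted P m -> counted Q m.
Proof.
move=> PQ [s [us sP ss]]; exists s; split=> // x.
by rewrite sP PQ.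
Qed.

Lemma counted_none T (P : T -> Prop) : (forall x, ~ P x) -> counted P 0.
Proof. by move=> nP; exists [::]; split=> // x; split=> // /nP. Qed.

Lemma counted_one T (P : T -> Prop) x0 :
  (forall x, P x <-> x = x0) -> counted P 1.
Proof.
move=> Px; exists [:: x0]; split=> // x.
by rewrite inE Px; split=> [/eqP|->].
Qed.

Lemma counted_disjU T (P Q : T -> Prop) m n :
    (forall x, P x -> Q x -> False) -> counted P m -> counted Q n ->
  counted (fun x => P x \/ Q x) (m + n).
Proof.
move=> PQ [s [us sP ss]] [t [ut tQ st]]; exists (s ++ t); split.
- rewrite cat_uniq us ut /= andbT; apply/hasPn => x /tQ Qx.
  by apply/negP => /sP /PQ; apply.
- move=> x; rewrite mem_cat; split.
    by case/orP=> [/sP|/tQ]; [left|right].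
  by case=> [/sP ->|/tQ ->] //; rewrite orbT.
- by rewrite size_cat ss st.
Qed.

Lemma counted_bigU T (I : eqType) (r : seq I) (Q : I -> T -> Prop)
    (m : I -> nat) :
    uniq r -> {in r, forall i, counted (Q i) (m i)} ->
    {in r &, forall i j x, Q i x -> Q j x -> i = j} ->
  counted (fun x => exists2 i, i \in r & Q i x) (\sum_(i <- r) m i).
Proof.
elim: r => [|i r IHr] /=.
  by move=> _ _ _; rewrite big_nil; apply: counted_none => x [].
move=> /andP[ir ur] cQ dQ; rewrite big_cons.
have cr : counted (fun x => exists2 j, j \in r & Q j x) (\sum_(j <- r) m j).
  apply: IHr => // [j jr|j k jr kr].
    by apply: cQ; rewrite inE jr orbT.
  by apply: dQ; rewrite inE ?jr ?kr orbT.
apply: counted_ext (counted_disjU _ (cQ i (mem_head i r)) cr) => [x|x Qi].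
  split=> [[Qi|[j jr Qj]]|[j]].
  - by exists i; rewrite ?mem_head.
  - by exists j; rewrite // inE jr orbT.
  - by rewrite inE => /orP[/eqP-> |jr] Qj; [left|right; exists j].
case=> j jr Qj; have jr' : j \in i :: r by rewrite inE jr orbT.
by move: ir; rewrite (dQ i j (mem_head i r) jr' x Qi Qj) jr.
Qed.

Lemma counted_image T U (P : T -> Prop) (f : T -> U) m :
    (forall x y, P x -> P y -> f x = f y -> x = y) -> counted P m ->
  counted (fun y => exists2 x, P x & y = f x) m.
Proof.
move=> injf [s [us sP ss]]; exists (map f s); split.
- by rewrite map_inj_in_uniq // => x y /sP Px /sP Py; apply: injf.
- move=> y; split=> [/mapP[x /sP Px ->]|[x /sP sx ->]]; first by exists x.
  exact: map_f.
- by rewrite size_map.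
Qed.

Lemma counted_pair T U (P : T -> Prop) (Q : U -> Prop) m n :
  counted P m -> counted Q n ->
  counted (fun p : T * U => P p.1 /\ Q p.2) (m * n).
Proof.
move=> [s [us sP ss]] [t [ut tQ st]].
exists [seq (x, y) | x <- s, y <- t]; split.
- by apply: allpairs_uniq => // -[? ?] [? ?].
- move=> [x y] /=; split=> [/allpairsP[[a b] /= [/sP Pa /tQ Qb [-> ->]]]|] //.
  by case=> /sP sx /tQ ty; apply/allpairsP; exists (x, y).
- by rewrite size_allpairs ss st.
Qed.

Lemma counted_sub T (p : pred T) (S : subEqType p) (P : T -> Prop) m :
  counted (fun x => p x /\ P x) m -> counted (fun u : S => P (val u)) m.
Proof.
move=> [s [us sP ss]]; exists (pmap insub s); split.
- exact: pmap_sub_uniq.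
- move=> u; rewrite mem_pmap_sub; split=> [/sP[]|Pu] //.
  by apply/sP; split=> //; apply: valP.
- rewrite size_pmap_sub -ss; apply/eqP; rewrite -all_count.
  by apply/allP => x /sP[].
Qed.

Lemma counted_neq T (P : T -> Prop) x0 m :
  P x0 -> counted P m -> counted (fun x => P x /\ x <> x0) m.-1.
Proof.
move=> P0 [s [us sP ss]]; exists (rem x0 s); split.
- exact: rem_uniq.
- move=> x; rewrite mem_rem_uniq // inE; split.
    by case/andP=> /eqP nx /sP.
  by case=> /sP -> /eqP ->.
- by rewrite size_rem ?ss //; apply/sP.
Qed.

Lemma counted_card (T : finType) (A : {pred T}) m :
  counted (fun x => x \in A) m -> #|A| = m.
Proof.
move=> [s [us sP <-]]; rewrite -(card_uniqP us); apply: eq_card => x.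
by apply/idP/idP => /sP.
Qed.

End Counted.

(** * Sums over subsets *)

(** Pascal's rule under a summation sign. *)
Lemma bin_sumS (n : nat) (g : nat -> nat) :
  \sum_(j < n.+2) 'C(n.+1, j) * g j =
  \sum_(j < n.+1) 'C(n, j) * g j + \sum_(j < n.+1) 'C(n, j) * g j.+1.
Proof.
rewrite big_ord_recl /= bin0 mul1n.
have -> : \sum_(i < n.+1) 'C(n.+1, bump 0 i) * g (bump 0 i) =
   \sum_(i < n.+1) 'C(n, i.+1) * g i.+1 + \sum_(i < n.+1) 'C(n, i) * g i.+1.
  rewrite -big_split /=; apply: eq_bigr => i _.
  by rewrite /bump /= add1n binS mulnDl.
rewrite addnA; congr (_ + _).
rewrite [in RHS]big_ord_recl /= bin0 mul1n; congr (_ + _).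
rewrite big_ord_recr /= bin_small // mul0n addn0.
by apply: eq_bigr => i _.
Qed.

Lemma sum_fpowerset (K : choiceType) (X : {fset K}) (g : nat -> nat) :
  \sum_(Y <- fpowerset X) g #|` Y| =
  \sum_(j < #|` X|.+1) 'C(#|` X|, j) * g j.
Proof.
move En : #|` X| => n; elim: n X g En => [|n IHn] X g En.
  move/cardfs0_eq: En => ->.
  by rewrite fpowerset0 big_seq_fset1 cardfs0 big_ord1 bin0 mul1n.
have [x xX] : exists x, x \in X.
  by apply/fset0Pn; rewrite -cardfs_gt0 En.
have EX : #|` (X `\ x)%fset| = n.
  by have := cardfsD1 x X; rewrite xX En add1n => -[].
rewrite bin_sumS -(IHn (X `\ x)%fset) // -(IHn (X `\ x)%fset (fun j => g j.+1)) //.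
rewrite (perm_big (fpowerset (X `\ x) ++
   [seq (x |` Y)%fset | Y <- fpowerset (X `\ x)])%fset) /=; last first.
  have xN Y : Y \in fpowerset (X `\ x)%fset -> x \notin Y.
    rewrite fpowersetE => /fsubsetP YX; apply/negP => /YX.
    by rewrite !inE eqxx.
  apply: uniq_perm => //.
    rewrite cat_uniq !fset_uniq /= map_inj_in_uniq ?fset_uniq ?andbT.
      by apply/hasPn => Z /mapP[Y _ ->]; apply/negP => /xN; rewrite !inE eqxx.
    move=> Y Z /xN xY /xN xZ YZ.
    by rewrite -(fsetU1K xY) YZ fsetU1K.
  move=> Y; rewrite mem_cat fpowersetE; apply/idP/idP.
    move=> YX; have [xY|xY] := boolP (x \in Y); last first.
      rewrite fpowersetE fsubsetD1 YX xY //.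
    apply/orP; right; apply/mapP; exists (Y `\ x)%fset; last by rewrite fsetD1K.
    by rewrite fpowersetE fsetSD.
  case/orP; first by rewrite fpowersetE fsubsetD1 => /andP[].
  case/mapP=> Z; rewrite fpowersetE fsubsetD1 => /andP[ZX _] ->.
  by rewrite fsubUset fsub1set xX.
rewrite big_cat big_map /=; congr (_ + _).
rewrite big_seq [RHS]big_seq; apply: eq_bigr => Y.
rewrite fpowersetE => /fsubsetP YX; rewrite cardfsU1.
suff -> : x \notin Y by [].
by apply/negP => /YX; rewrite !inE eqxx.
Qed.

Lemma sum_subset (T : finType) (A : {set T}) (g : nat -> nat) :
  \sum_(B <- enum (powerset A)) g #|B| = \sum_(j < #|A|.+1) 'C(#|A|, j) * g j.
Proof.
rewrite big_enum /=.
rewrite (partition_big (fun B : {set T} => inord #|B| : 'I_#|A|.+1) xpredT) //=.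
apply: eq_bigr => j _.
have sel (B : {set T}) : (B \in powerset A) && (inord #|B| == j) =
    (B \in [set B : {set T} | (B \subset A) && (#|B| == j)]).
  rewrite !inE; case sBA: (B \subset A) => //=.
  by rewrite -val_eqE /= inordK // ltnS subset_leq_card.
under eq_bigl do rewrite sel.
rewrite (eq_bigr (fun=> g j)); last first.
  by move=> B; rewrite inE => /andP[_ /eqP->].
by rewrite sum_nat_const cards_draws.
Qed.

(** * The counting sequences *)

(** The right-hand side of the recurrence for f(m+1), computed from the list l
    of the values f(0), ..., f(m); the inner sum is a(j+1). *)
Definition forest_step (m : nat) (l : seq nat) : nat :=
  \sum_(j < m.+1)
    'C(m, j) * (\sum_(i < j.+1) 'C(j.+1, i) * nth 0 l i) * nth 0 l (m - j).

(** The list of f(0), ..., f(n). *)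
Fixpoint forest_seq (n : nat) : seq nat :=
  if n is m.+1 then rcons (forest_seq m) (forest_step m (forest_seq m))
  else [:: 1].

(** The number f(n) of forests of rooted blow-ups on n labels. *)
Definition forest_num (n : nat) : nat := nth 0 (forest_seq n) n.

(** The number a(m) of rooted blow-up trees on m labels; i is the number of
    labels outside the root block. *)
Definition rooted_num (m : nat) : nat :=
  \sum_(i < m) 'C(m, i) * forest_num i.

Lemma size_forest_seq n : size (forest_seq n) = n.+1.
Proof. by elim: n => //= n IHn; rewrite size_rcons IHn. Qed.

Lemma nth_forest_seq n i : i <= n -> nth 0 (forest_seq n) i = forest_num i.
Proof.
elim: n => [|n IHn]; first by case: i.
rewrite leq_eqVlt => /orP[/eqP-> //|]; rewrite ltnS => lein.
by rewrite /= nth_rcons size_forest_seq ltnS lein IHn.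
Qed.

Lemma forest_num0 : forest_num 0 = 1.
Proof. by []. Qed.

Lemma forest_numS n :
  forest_num n.+1 =
  \sum_(j < n.+1) 'C(n, j) * (rooted_num j.+1 * forest_num (n - j)).
Proof.
rewrite {1}/forest_num /= nth_rcons size_forest_seq ltnn eqxx.
apply: eq_bigr => j _; rewrite mulnA nth_forest_seq ?leq_subr //.
congr (_ * _ * _); apply: eq_bigr => i _.
by rewrite nth_forest_seq // (leq_trans (leq_ord i)) // leq_ord.
Qed.

Lemma forest_num_gt0 n : 0 < forest_num n.
Proof.
elim/ltn_ind: n => -[|n] IHn //.
rewrite forest_numS big_ord_recl /= bin0 mul1n subn0 addn_gt0.
by rewrite /rooted_num big_ord1 bin0 forest_num0 mul1n mul1n IHn.
Qed.

(** The number of connected 3-leaf power graphs on n >= 1 labels: the complete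
    graph, and for each block of a fixed vertex, with j vertices outside it,
    the forests on these vertices that do not yield the complete graph. *)
Definition graph_num (n : nat) : nat :=
  (\sum_(j < n) 'C(n.-1, j) * (forest_num j).-1).+1.

(** The same sequences in binary arithmetic, for evaluation. *)
Definition sumN (n : nat) (F : nat -> N) : N :=
  foldr (fun j s => (F j + s)%num) 0%num (iota 0 n).

Fixpoint binN (n m : nat) : N :=
  match n, m with
  | n'.+1, m'.+1 => (binN n' m + binN n' m')%num
  | _, 0 => 1%num
  | 0, _.+1 => 0%num
  end.

Definition forest_stepN (m : nat) (l : seq N) : N :=
  sumN m.+1 (fun j =>
    binN m j * sumN j.+1 (fun i => binN j.+1 i * nth 0 l i)
      * nth 0 l (m - j))%num.

Fixpoint forest_seqN (n : nat) : seq N :=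
  if n is m.+1 then
    let l := forest_seqN m in rcons l (forest_stepN m l)
  else [:: 1%num].

Definition graph_numN (n : nat) : N :=
  let l := forest_seqN n.-1 in
  (1 + sumN n (fun j => binN n.-1 j * N.pred (nth 0 l j)))%num.

Lemma nat_of_binD p q : nat_of_bin (p + q)%num = nat_of_bin p + nat_of_bin q.
Proof. by case: p q => [|p] [|q] //=; rewrite ?addn0 // nat_of_add_pos. Qed.

Lemma nat_of_binM p q : nat_of_bin (p * q)%num = nat_of_bin p * nat_of_bin q.
Proof. by case: p q => [|p] [|q] //=; rewrite ?muln0 // nat_of_mul_pos. Qed.

Lemma sumNE n F : nat_of_bin (sumN n F) = \sum_(j < n) nat_of_bin (F j).
Proof.
rewrite -(big_mkord xpredT (fun j => nat_of_bin (F j))) /index_iota subn0.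
rewrite /sumN; elim: (iota 0 n) => [|j s IHs] /=; first by rewrite big_nil.
by rewrite big_cons nat_of_binD IHs.
Qed.

Lemma binNE n m : nat_of_bin (binN n m) = 'C(n, m).
Proof.
elim: n m => [|n IHn] [|m] //=.
by rewrite nat_of_binD !IHn binS.
Qed.

Lemma forest_stepNE m l :
  nat_of_bin (forest_stepN m l) = forest_step m (map nat_of_bin l).
Proof.
have nthE i : nth 0 (map nat_of_bin l) i = nat_of_bin (nth 0%num l i).
  elim: l i => [|x l IHl] [|i] //=.
rewrite sumNE; apply: eq_bigr => j _; rewrite !nat_of_binM binNE sumNE nthE.
congr (_ * _ * _); apply: eq_bigr => i _.
by rewrite nat_of_binM binNE nthE.
Qed.

Lemma forest_seqNE n : map nat_of_bin (forest_seqN n) = forest_seq n.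
Proof.
by elim: n => //= n IHn; rewrite map_rcons forest_stepNE IHn.
Qed.

Lemma graph_numNE n : 0 < n -> nat_of_bin (graph_numN n) = graph_num n.
Proof.
case: n => // n _.
rewrite /graph_numN /graph_num nat_of_binD add1n sumNE /=; congr _.+1.
apply: eq_bigr => j _; rewrite nat_of_binM binNE; congr (_ * _).
rewrite -(nth_forest_seq (n := n)) ?leq_ord // -forest_seqNE.
rewrite (nth_map 0%num); last first.
  by rewrite -(size_map nat_of_bin) forest_seqNE size_forest_seq.
have predE p : nat_of_bin (N.pred p) = (nat_of_bin p).-1.
  case: p => // p; rewrite -(N.succ_pred (N.pos p)) // N.pred_succ.
  by rewrite -N.add_1_r nat_of_binD addn1.
by rewrite predE.
Qed.

Lemma graph_num_values :
  [seq graph_num n | n <- iota 1 12] =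
  [seq nat_of_bin m | m <-
     [:: 1; 1; 4; 35; 361; 4482; 68027; 1238841; 26416474; 646139853;
         17837851021; 548713086352]%num].
Proof.
have -> : [seq graph_num n | n <- iota 1 12] =
    [seq nat_of_bin (graph_numN n) | n <- iota 1 12].
  by apply/eq_in_map => n; rewrite mem_iota => /andP[n_gt0 _]; rewrite graph_numNE.
rewrite (map_comp nat_of_bin graph_numN).
by apply: (congr1 (map nat_of_bin)); vm_compute.
Qed.

(** * Counting the constructions on labelled classes *)

Section Classes.
Local Open Scope fset_scope.
Implicit Types (A B : lclass) (X Y : {fset nat}).

(** The class A has exactly m objects with label set X. *)
Definition class_counted A X m := counted (fun x : obj A => labels x = X) m.

Lemma class_counted_iso A B X m :
  (A ~= B)%L -> class_counted B X m -> class_counted A X m.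
Proof.
case=> f [[g fK gK] fl] cB.
apply: counted_ext (counted_image (f := g) _ cB) => [x|x y _ _ /(can_inj gK)//].
split=> [[y <- ->]|<-]; first by rewrite -fl gK.
by exists (f x); rewrite ?fl ?fK.
Qed.

Lemma class_counted_sum A B X m n :
  class_counted A X m -> class_counted B X n -> class_counted (A + B)%L X (m + n).
Proof.
move=> cA cB.
have cA' := counted_image (f := @inl (obj A) (obj B))
  (fun x y _ _ e => let: erefl := e in erefl) cA.
have cB' := counted_image (f := @inr (obj A) (obj B))
  (fun x y _ _ e => let: erefl := e in erefl) cB.
apply: counted_ext (counted_disjU _ cA' cB') => [[x|x]|[x|x]] /=.
- split=> [[[y <- [->]]|[]]|] //; by left; exists x.
- split=> [[[]|[y <- [->]]]|] //; by right; exists x.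
- by move=> _ [].
- by case.
Qed.

(** The second hypothesis is only required at the label sets that are left over
    by an object of A, so that the lemma can be used in a recursion where A has
    no object without labels. *)
Lemma class_counted_prod A B X (a b : nat -> nat) :
    (forall Y, Y `<=` X -> class_counted A Y (a #|` Y|)) ->
    (forall Y, Y `<=` X -> a #|` X `\` Y| != 0 -> class_counted B Y (b #|` Y|)) ->
  class_counted (A * B)%L X
    (\sum_(j < #|` X|.+1) 'C(#|` X|, j) * (a j * b (#|` X| - j))).
Proof.
move=> cA cB.
pose S := obj (A * B)%L.
pose P (p : obj A * obj B) := labels p.1 `|` labels p.2 = X.
apply: (@counted_sub _ _ S P).
pose Q Y (p : obj A * obj B) := labels p.1 = Y /\ labels p.2 = X `\` Y.
rewrite -(sum_fpowerset X (fun j => a j * b (#|` X| - j))).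
apply: counted_ext (counted_bigU (Q := Q) _ _ _).
- move=> [x y]; rewrite /P /Q /=; split.
    case=> Y; rewrite fpowersetE => YX [-> ->]; split.
      by apply/fdisjointP => i iY; rewrite inE iY.
    by rewrite fsetUDl fsetDv fsetD0; apply/fsetUidPr.
  case=> dxy <-; exists (labels x); first by rewrite fpowersetE fsubsetUl.
  by split=> //; rewrite fsetDUl fsetDv fset0U; apply/esym/fsetDidPl; rewrite fdisjoint_sym.
- exact: fset_uniq.
- move=> Y; rewrite fpowersetE => YX.
  have cY : #|` X| - #|` Y| = #|` X `\` Y| by rewrite cardfsDS.
  (* If no object of A has label set Y, then nothing is known about B. *)
  have [a0|an0] := eqVneq (a #|` Y|) 0.
    rewrite a0 mul0n; case: (cA Y YX); rewrite a0 => s [_ sP /size0nil s0].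
    by apply: counted_none => x -[/sP]; rewrite s0.
  rewrite cY; apply: (@counted_pair _ _ (fun x : obj A => labels x = Y)
    (fun y : obj B => labels y = X `\` Y)); first exact: cA.
  apply: cB; first exact: fsubsetDl.
  suff -> : X `\` (X `\` Y) = Y by [].
  by rewrite fsetDK.
- by move=> Y Z _ _ p [<- _] [<- _].
Qed.

Lemma class_counted_atom X : class_counted 'Z%L X (#|` X| == 1).
Proof.
have [/cardfs1P[i ->]|nX] := boolP (#|` X| == 1).
  apply: (counted_one (x0 := i)) => j /=.
  by split=> [/fset1_inj|->].
apply: counted_none => i /= eX; move: nX.
by rewrite -eX cardfs1.
Qed.

Section Sets.
Variable A : lclass.
Hypothesis labels_neq0 : forall x : obj A, labels x != fset0.

(** The condition on the sets of objects in the construction Set. *)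
Definition disjoint_labels (S : {fset obj A}) : bool :=
  [forall x : S, forall y : S,
     (x != y) ==> fdisjoint (labels (val x)) (labels (val y))].

Definition set_labels (S : {fset obj A}) : {fset nat} :=
  \bigcup_(x <- S) labels x.

Lemma disjoint_labelsP (S : {fset obj A}) :
  reflect {in S &, forall x y, x != y -> fdisjoint (labels x) (labels y)}
          (disjoint_labels S).
Proof.
apply: (iffP idP) => [/forallP dS x y xS yS nxy|dS].
  by have /forallP/(_ [` yS])/implyP := dS [` xS]; apply.
apply/forallP => x; apply/forallP => y; apply/implyP => nxy.
by apply: dS => //; apply: valP.
Qed.

Lemma set_labelsP (S : {fset obj A}) i :
  reflect (exists2 x, x \in S & i \in labels x) (i \in set_labels S).
Proof.
apply: (iffP (bigfcupP _ _ _ _)) => [[x /andP[xS _] ix]|[x xS ix]].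
  by exists x.
by exists x; rewrite ?xS.
Qed.

Lemma set_labels_eq0 S : (set_labels S == fset0) = (S == fset0).
Proof.
apply/eqP/eqP => [S0|->]; last by rewrite /set_labels big_seq_fset0.
apply/eqP; rewrite -[_ == _]negbK; apply/negP => /fset0Pn[x xS].
have /fset0Pn[i ix] := labels_neq0 x.
have : i \in set_labels S by apply/set_labelsP; exists x.
by rewrite S0 inE.
Qed.

Lemma set_labelsU1 x S : set_labels (x |` S) = labels x `|` set_labels S.
Proof.
apply/fsetP => i; rewrite inE; apply/set_labelsP/orP.
  case=> y; rewrite !inE => /orP[/eqP->|yS] iy; first by left.
  by right; apply/set_labelsP; exists y.
case=> [ix|/set_labelsP[y yS iy]]; first by exists x; rewrite ?inE ?eqxx.
by exists y; rewrite // !inE yS orbT.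
Qed.

(** S is a set of objects with disjoint label sets that partition X. *)
Definition label_partition X (S : {fset obj A}) : Prop :=
  disjoint_labels S /\ set_labels S = X.

Lemma label_partitionU1 X Y x S :
    Y `<=` X -> labels x = Y -> label_partition (X `\` Y) S ->
  label_partition X (x |` S).
Proof.
move=> YX lx [dS lS]; split; last first.
  by rewrite set_labelsU1 lx lS fsetUDl fsetDv fsetD0; apply/fsetUidPr.
have dx y : y \in S -> fdisjoint Y (labels y).
  move=> yS; apply/fdisjointP => i iY; apply/negP => iy.
  have : i \in set_labels S by apply/set_labelsP; exists y.
  by rewrite lS inE iY.
apply/disjoint_labelsP => y z; rewrite !inE.
case/orP=> [/eqP->|yS] /orP[/eqP->|zS] nyz.
- by rewrite eqxx in nyz.
- by rewrite lx dx.
- by rewrite fdisjoint_sym lx dx.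
- exact: (disjoint_labelsP _ dS).
Qed.

Lemma label_partitionD1 X x S :
  x \in S -> label_partition X S -> label_partition (X `\` labels x) (S `\ x).
Proof.
move=> xS [/disjoint_labelsP dS <-]; split.
  apply/disjoint_labelsP => y z; rewrite !inE => /andP[_ yS] /andP[_ zS].
  exact: dS.
apply/fsetP => i; rewrite inE; apply/set_labelsP/andP.
  case=> y; rewrite !inE => /andP[nyx yS] iy; split.
    by have /fdisjointP := dS _ _ yS xS nyx; apply.
  by apply/set_labelsP; exists y.
case=> nix /set_labelsP[y yS iy]; exists y => //; rewrite !inE yS andbT.
by apply: contraNneq nix => <-.
Qed.

(** The exponential formula, as a recurrence: a label v of X is chosen, and the
    object that carries v is split off.  The set Z below consists of the other
    labels of this object. *)
Lemma counted_label_partition (a F : nat -> nat) X :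
    F 0 = 1 ->
    (forall n, F n.+1 = \sum_(j < n.+1) 'C(n, j) * (a j.+1 * F (n - j))) ->
    (forall Y, Y `<=` X -> class_counted A Y (a #|` Y|)) ->
  counted (label_partition X) (F #|` X|).
Proof.
move=> F0 FS; move En : #|` X| => n; elim/ltn_ind: n X En => n IHn X En cA.
have [X0|[v vX]] := fset_0Vmem X.
  rewrite X0 cardfs0 in En; rewrite -En F0 X0.
  apply: (counted_one (x0 := fset0)) => S; split=> [[_ /eqP]|->].
    by rewrite set_labels_eq0 => /eqP.
  split; last by rewrite /set_labels big_seq_fset0.
  by apply/disjoint_labelsP => x y; rewrite inE.
have EX : #|` X| = #|` X `\ v|.+1 by rewrite (cardfsD1 v X) vX.
case: n IHn En => [|n] IHn En; first by rewrite En in EX.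
have En' : #|` X `\ v| = n by move: EX; rewrite En => -[].
pose Q (Z : {fset nat}) S := exists2 p : obj A * {fset obj A},
  labels p.1 = v |` Z /\ label_partition (X `\` (v |` Z)) p.2 & S = p.1 |` p.2.
rewrite FS -En' -(sum_fpowerset (X `\ v) (fun j => a j.+1 * F (#|` X `\ v| - j))).
have sub Z : Z \in fpowerset (X `\ v) -> v |` Z `<=` X.
  rewrite fpowersetE fsubsetD1 fsubUset fsub1set vX => /andP[] //.
have vNZ Z : Z \in fpowerset (X `\ v) -> v \notin Z.
  by rewrite fpowersetE fsubsetD1 => /andP[].
apply: counted_ext (counted_bigU (Q := Q) _ _ _).
- move=> S; split.
    case=> Z /sub ZX [[x S'] /= [lx lS'] ->].
    by apply: label_partitionU1 ZX lx lS'.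
  move=> lS; have [_ eS] := lS.
  have /set_labelsP[x xS vx] : v \in set_labels S by rewrite eS.
  exists (labels x `\ v).
    rewrite fpowersetE; apply: fsetSD; rewrite -eS; apply/fsubsetP => i ix.
    by apply/set_labelsP; exists x.
  exists (x, S `\ x); rewrite /= ?fsetD1K //.
  by split=> //; apply: label_partitionD1.
- exact: fset_uniq.
- move=> Z ZX; have cZ : #|` v |` Z| = #|` Z|.+1 by rewrite cardfsU1 vNZ.
  apply: (@counted_image _ _ (fun p : obj A * {fset obj A} =>
    labels p.1 = v |` Z /\ label_partition (X `\` (v |` Z)) p.2)
    (fun p => p.1 |` p.2)); last first.
    apply: (@counted_pair _ _ (fun x : obj A => labels x = v |` Z)
      (label_partition (X `\` (v |` Z)))); first by rewrite -cZ; apply: cA; apply: sub.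
    have cD : #|` X `\` (v |` Z)| = #|` X `\ v| - #|` Z|.
      by rewrite cardfsDS ?sub // EX cZ subSS.
    apply: IHn; rewrite ?cD //.
      by rewrite En' ltnS leq_subr.
    by move=> Y YX; apply: cA; apply: fsubset_trans YX (fsubsetDl _ _).
  move=> [x S] [y T] /= [lx [dS lS]] [ly [dT lT]] e.
  have notin z U : labels z = v |` Z -> set_labels U = X `\` (v |` Z) ->
      z \notin U.
    move=> lz lU; apply/negP => zU.
    have : v \in set_labels U by apply/set_labelsP; exists z; rewrite ?lz ?fset1U1.
    by rewrite lU !inE eqxx.
  have exy : x = y.
    have : x \in y |` T by rewrite -e fset1U1.
    rewrite !inE => /orP[/eqP//|xT].
    by have := notin x T lx lT; rewrite xT.
  rewrite exy -(fsetU1K (notin _ _ lx lS)) e exy fsetU1K //.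
  exact: notin ly lT.
- move=> Z W ZX WX S [[x S1] /= [lx [_ lS1]] eS] [[y S2] /= [ly [_ lS2]] eS'].
  have exy : x = y.
    have : x \in y |` S2 by rewrite -eS' eS fset1U1.
    rewrite !inE => /orP[/eqP//|xS2].
    have : v \in set_labels S2 by apply/set_labelsP; exists x; rewrite ?lx ?fset1U1.
    by rewrite lS2 !inE eqxx.
  by rewrite -(fsetU1K (vNZ _ ZX)) -(fsetU1K (vNZ _ WX)) -lx -ly exy.
Qed.

Lemma class_counted_set_ge k X m :
  counted (fun S : {fset obj A} => (k <= #|` S|)%N /\ label_partition X S) m ->
  class_counted (Set_ge k A)%L X m.
Proof.
move=> c; apply: (@counted_sub _ _ (obj (Set_ge k A)%L)
  (fun S => set_labels S = X)).
apply: counted_ext c => S; split=> [[kS [dS lS]]|[/andP[kS dS] lS]].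
  by split=> //; apply/andP.
by [].
Qed.

Lemma class_counted_set_ge1 X m :
  counted (label_partition X) m ->
  class_counted (Set_ge 1 A)%L X (if #|` X| == 0 then 0 else m).
Proof.
move=> c; apply: class_counted_set_ge; rewrite cardfs_eq0.
have [->|Xn0] := eqVneq X fset0.
  apply: counted_none => S [S0 [_ /eqP]]; rewrite set_labels_eq0 => /eqP eS.
  by rewrite eS cardfs0 in S0.
apply: counted_ext c => S; split=> [lS|[]//]; split=> //.
rewrite cardfs_gt0 -set_labels_eq0.
by case: lS => _ ->.
Qed.

(** A set with label set X has at least two elements unless it is a singleton
    or X is empty. *)
Lemma class_counted_set_ge2 X m n :
  counted (label_partition X) m -> class_counted A X n ->
  class_counted (Set_ge 2 A)%L X (if #|` X| == 0 then 0 else m - n).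
Proof.
move=> [s [us sP sm]] cA; apply: class_counted_set_ge; rewrite cardfs_eq0.
have [->|Xn0] := eqVneq X fset0.
  apply: counted_none => S [S0 [_ /eqP]]; rewrite set_labels_eq0 => /eqP eS.
  by rewrite eS cardfs0 in S0.
have c1 : counted (fun S : {fset obj A} =>
    exists2 x, labels x = X & S = [fset x]) n.
  by apply: (@counted_image _ _ _ (fun x : obj A => [fset x]) _ _ cA) =>
    x y _ _ /fset1_inj.
have [t [ut tP tn]] := c1.
have ts : {subset t <= s}.
  move=> S /tP[x lx ->]; apply/sP; split.
    apply/disjoint_labelsP => y z; rewrite !inE => /eqP-> /eqP->.
    by rewrite eqxx.
  by rewrite /set_labels big_seq_fset1.
exists [seq S <- s | S \notin t]; split.
- exact: filter_uniq.
- move=> S; rewrite mem_filter; split.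
    case/andP=> /negP St /sP lS; split=> //.
    rewrite ltnNge leq_eqVlt ltnS leqn0 cardfs_eq0 negb_or; apply/andP; split.
      apply/negP => /cardfs1P[x eS]; apply: St; apply/tP; exists x => //.
      by case: lS => _; rewrite eS /set_labels big_seq_fset1.
    rewrite -set_labels_eq0; by case: lS => _ ->.
  case=> S2 lS; apply/andP; split; last exact/sP.
  by apply/negP => /tP[x _ eS]; rewrite eS cardfs1 in S2.
- rewrite size_filter -sm -tn.
  rewrite -(count_predC (mem t) s) addnC.
  suff -> : count (mem t) s = size t by rewrite addnK.
  rewrite -size_filter; apply: perm_size; apply: uniq_perm => //.
    exact: filter_uniq.
  move=> S; rewrite mem_filter; apply/andP/idP => [[]//|St].
  by split=> //; apply: ts.
Qed.

End Sets.
End Classes.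

(** * The class 3LP *)

Lemma bin_sum_rev n (g : nat -> nat) :
  \sum_(j < n.+1) 'C(n, j) * g (n - j) = \sum_(j < n.+1) 'C(n, j) * g j.
Proof.
rewrite (reindex_inj rev_ord_inj) /=; apply: eq_bigr => j _.
by rewrite subSS subKn ?leq_ord // bin_sub // leq_ord.
Qed.

Lemma bin_sum_atom n (g : nat -> nat) :
  \sum_(j < n.+1) 'C(n, j) * ((j == 1 :> nat) * g (n - j)) = n * g n.-1.
Proof.
case: n => [|n]; first by rewrite big_ord1 mul0n.
rewrite 2!big_ord_recl big1 ?addn0 => [|j _]; last by rewrite mul0n muln0.
by rewrite mul0n muln0 add0n mul1n bin1 subn1.
Qed.

Lemma rooted_num_le n : 0 < n -> rooted_num n <= forest_num n.
Proof.
case: n => // n _; rewrite forest_numS big_ord_recr /= binn subnn forest_num0.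
by rewrite mul1n muln1 leq_addl.
Qed.

(** L + SX has a(n) objects on n labels: one object of L if n > 0, and an object
    of SX is an object of L with j > 0 labels together with a nonempty set of
    subtrees on the other labels. *)
Lemma rooted_numE n :
  (0 < n) + \sum_(j < n.+1) 'C(n, j) *
     ((0 < j) * (if n - j == 0 then 0 else forest_num (n - j))) =
  rooted_num n.
Proof.
pose g m := if m == 0 then 0 else forest_num m.
have -> : \sum_(j < n.+1) 'C(n, j) *
     ((0 < j) * (if n - j == 0 then 0 else forest_num (n - j))) =
    \sum_(j < n.+1) 'C(n, j) * ((0 < n - j) * g j).
  rewrite -(bin_sum_rev n (fun j => (0 < n - j) * g j)); apply: eq_bigr => j _.
  by rewrite subKn // leq_ord.
rewrite big_ord_recr /= subnn mul0n muln0 addn0 /rooted_num.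
rewrite (eq_bigr (fun j : 'I_n => 'C(n, j) * g j)) => [|j _]; last first.
  by rewrite subn_gt0 ltn_ord mul1n.
case: n => [|n]; first by rewrite !big_ord0.
by rewrite !big_ord_recl /= /g /= bin0 muln0 add0n.
Qed.

Section System.
Local Open Scope fset_scope.
Variables LP SC SX L Lp Kp : lclass.
Hypothesis LP_def : (LP ~= Lp * (SC + SX) + Kp)%L.
Hypothesis SC_def : (SC ~= Set_ge 2 (L + SX))%L.
Hypothesis SX_def : (SX ~= L * Set_ge 1 (L + SX))%L.
Hypothesis L_def : (L ~= 'Z + Set_ge 2 'Z)%L.
Hypothesis Lp_def : (Lp ~= 'Zp + 'Zp * Set_ge 1 'Z)%L.
Hypothesis Kp_def : (Kp ~= 'Zp * Set_ge 2 'Z)%L.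

Lemma labels_atom_neq0 (x : obj 'Z%L) : labels x != fset0.
Proof. by apply/fset0Pn; exists x; rewrite /= inE. Qed.

Lemma atom_partitions X : counted (@label_partition 'Z%L X) 1.
Proof.
apply: (counted_label_partition labels_atom_neq0 (a := fun n => n == 1)
  (F := fun=> 1)) => // [n|Y _]; last exact: class_counted_atom.
rewrite big_ord_recl big1 ?addn0 => [|j _]; first by rewrite bin0.
by rewrite muln0.
Qed.

Lemma counted_set_ge1_atom X : class_counted (Set_ge 1 'Z)%L X (0 < #|` X|).
Proof.
have := class_counted_set_ge1 labels_atom_neq0 (atom_partitions X).
by case: #|` X|.
Qed.

Lemma counted_set_ge2_atom X : class_counted (Set_ge 2 'Z)%L X (1 < #|` X|).
Proof.
have := class_counted_set_ge2 labels_atom_neq0 (atom_partitions X)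
  (class_counted_atom X).
by case: #|` X| => [|[]].
Qed.

Lemma counted_L X : class_counted L X (0 < #|` X|).
Proof.
apply: class_counted_iso L_def _.
have := class_counted_sum (class_counted_atom X) (counted_set_ge2_atom X).
by case: #|` X| => [|[]].
Qed.

Lemma counted_Lp X : class_counted Lp X #|` X|.
Proof.
apply: class_counted_iso Lp_def _.
have := @class_counted_prod _ _ X (fun n => n == 1) (fun n => 0 < n)
  (fun Y _ => class_counted_atom Y) (fun Y _ _ => counted_set_ge1_atom Y).
move/(class_counted_sum (class_counted_atom X)).
rewrite (bin_sum_atom _ (fun n => nat_of_bool (0 < n))).
by case: #|` X| => [|[|n]] //=; rewrite muln1.
Qed.

Lemma counted_Kp X : class_counted Kp X (#|` X| * (1 < #|` X|.-1)).
Proof.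
apply: class_counted_iso Kp_def _.
have := @class_counted_prod _ _ X (fun n => n == 1) (fun n => 1 < n)
  (fun Y _ => class_counted_atom Y) (fun Y _ _ => counted_set_ge2_atom Y).
by rewrite (bin_sum_atom _ (fun n => nat_of_bool (1 < n))).
Qed.

Lemma labels_L_neq0 (x : obj L) : labels x != fset0.
Proof.
apply/negP => /eqP lx; have [s [_ sP ss]] := counted_L fset0.
have : x \in s by apply/sP.
by move: ss; rewrite cardfs0; case: s {sP}.
Qed.

Lemma labels_LSX_neq0 (x : obj (L + SX)%L) : labels x != fset0.
Proof.
case: x => [x|x]; first exact: labels_L_neq0.
case: SX_def => f [_ fl]; rewrite /= -fl /=.
have /fset0Pn[i ix] := labels_L_neq0 (val (f x)).1.
by apply/fset0Pn; exists i; rewrite inE ix.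
Qed.

(** The number of objects of SX on n labels. *)
Definition SX_num n := \sum_(j < n.+1) 'C(n, j) *
     ((0 < j) * (if n - j == 0 then 0 else forest_num (n - j))).

(** By induction on the size of the label set: the root of an object of SX takes
    at least one label. *)
Lemma counted_SX X : class_counted SX X (SX_num #|` X|).
Proof.
move En : #|` X| => n; elim/ltn_ind: n X En => n IHn X En.
apply: class_counted_iso SX_def _; rewrite -En.
apply: (class_counted_prod (a := fun j => nat_of_bool (0 < j))
  (b := fun j => if j == 0 then 0 else forest_num j)) => Y YX.
  exact: counted_L.
rewrite eqb0 negbK => XDY.
apply: class_counted_set_ge1 labels_LSX_neq0 _ _ _.
have YltX : #|` Y| < n.
  rewrite -En ltn_neqAle fsubset_leq_card // andbT.
  by move: XDY; rewrite cardfsDS // subn_gt0 ltn_neqAle => /andP[].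
apply: (counted_label_partition labels_LSX_neq0 (a := rooted_num)).
- exact: forest_num0.
- exact: forest_numS.
move=> Z ZY; rewrite -rooted_numE; apply: class_counted_sum; first exact: counted_L.
apply: IHn => //; apply: leq_ltn_trans YltX; exact: fsubset_leq_card.
Qed.

Lemma counted_LSX X : class_counted (L + SX)%L X (rooted_num #|` X|).
Proof.
by rewrite -rooted_numE; apply: class_counted_sum (counted_L X) (counted_SX X).
Qed.

Lemma counted_SC X :
  class_counted SC X
    (if #|` X| == 0 then 0 else forest_num #|` X| - rooted_num #|` X|).
Proof.
apply: class_counted_iso SC_def _.
apply: (class_counted_set_ge2 labels_LSX_neq0); last exact: counted_LSX.
apply: (counted_label_partition labels_LSX_neq0 (a := rooted_num)).
- exact: forest_num0.
- exact: forest_numS.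
by move=> Y _; apply: counted_LSX.
Qed.

Lemma counted_SC_SX X :
  class_counted (SC + SX)%L X (forest_num #|` X|).-1.
Proof.
have := class_counted_sum (counted_SC X) (counted_SX X).
have := rooted_numE #|` X|; rewrite -/(SX_num _).
have := @rooted_num_le #|` X|.
case: #|` X| => [|n] /=.
  by move=> _; rewrite /rooted_num big_ord0 => ->.
move=> /(_ isT) le_rf; rewrite add1n => eS.
suff -> : (forest_num n.+1 - rooted_num n.+1 + SX_num n.+1 =
  (forest_num n.+1).-1)%N by [].
by apply: succn_inj; rewrite -addnS eS subnK // prednK // forest_num_gt0.
Qed.

Lemma counted_LP X : 2 < #|` X| -> class_counted LP X (#|` X| * graph_num #|` X|).
Proof.
move=> X2; apply: class_counted_iso LP_def _.
have := @class_counted_prod _ _ X id (fun n => (forest_num n).-1)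
  (fun Y _ => counted_Lp Y) (fun Y _ _ => counted_SC_SX Y).
move/class_counted_sum => /(_ _ _ (counted_Kp X)).
case: #|` X| X2 => [|n] //; rewrite ltnS => n2.
suff -> : (\sum_(j < n.+2) 'C(n.+1, j) * (j * (forest_num (n.+1 - j)).-1) +
     n.+1 * (1 < n.+1.-1) = n.+1 * graph_num n.+1)%N by [].
rewrite /= n2 /graph_num muln1 mulnS [LHS]addnC; congr addn.
rewrite -(bin_sum_rev n (fun j => (forest_num j).-1)) big_distrr /=.
rewrite big_ord_recl mul0n muln0 add0n; apply: eq_bigr => j _.
by rewrite subSS /= mulnCA mulnA (mulnA n.+1) (mul_bin_diag n.+1).
Qed.

End System.

(** * Blow-up forests *)

(** Graphs are represented from here on by their sets of ordered pairs of
    adjacent vertices. *)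

Section Forests.
Variable V : finType.
Implicit Types (A B D M : {set V}) (E : {set V * V}).

(** The graph E with B turned into a clique that is joined to all of M. *)
Definition attach B M E : {set V * V} :=
  E :|: [set p | (p.1 != p.2) &&
    ((p.1 \in B) && (p.2 \in B :|: M) || (p.2 \in B) && (p.1 \in B :|: M))].

(** [blowup_forest A M E]: the graph E on the vertex set A is the disjoint union
    of rooted blow-up trees, and M is the union of their root blocks.  A
    nonempty forest consists of a root block B, the forest (A1, M1, E1) of the
    children of B, and the forest (A2, M2, E2) of the other trees. *)
Inductive blowup_forest : {set V} -> {set V} -> {set V * V} -> Prop :=
| blowup_forest0 : blowup_forest set0 set0 set0
| blowup_forestU B A1 M1 E1 A2 M2 E2 :
    B != set0 -> [disjoint B & A1] -> [disjoint B :|: A1 & A2] ->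
    blowup_forest A1 M1 E1 -> blowup_forest A2 M2 E2 ->
  blowup_forest (B :|: A1 :|: A2) (B :|: M2) (attach B M1 E1 :|: E2).

(** E is on D the graph of a rooted blow-up tree with root block B. *)
Definition blowup_tree D B E : Prop :=
  exists M1 E1, [/\ B != set0, B \subset D, blowup_forest (D :\: B) M1 E1 &
    E = attach B M1 E1].

Lemma blowup_forest_tree D B E A2 M2 E2 :
    blowup_tree D B E -> [disjoint D & A2] -> blowup_forest A2 M2 E2 ->
  blowup_forest (D :|: A2) (B :|: M2) (E :|: E2).
Proof.
case=> M1 [E1 [B0 BD F1 ->]] dDA F2.
have eD : B :|: (D :\: B) = D.
  apply/setP => x; rewrite !inE.
  by have [/(subsetP BD)->|//] := boolP (x \in B).
rewrite -{1}eD; apply: blowup_forestU => //; last by rewrite eD.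
by rewrite -setI_eq0 setIDA setIC -setIDA setDv setI0.
Qed.

(** Induction on forests, with the vertex set D of the first tree made
    explicit. *)
Lemma blowup_forest_tree_ind (P : {set V} -> {set V} -> {set V * V} -> Prop) :
    P set0 set0 set0 ->
    (forall D B M1 E1 A2 M2 E2, B != set0 -> B \subset D ->
      [disjoint D & A2] -> blowup_forest (D :\: B) M1 E1 -> P (D :\: B) M1 E1 ->
      blowup_forest A2 M2 E2 -> P A2 M2 E2 ->
      P (D :|: A2) (B :|: M2) (attach B M1 E1 :|: E2)) ->
  forall A M E, blowup_forest A M E -> P A M E.
Proof.
move=> P0 PU A M E; elim=> // B A1 M1 E1 A2 M2 E2 B0 dB dA F1 IH1 F2 IH2.
have eA : (B :|: A1) :\: B = A1.
  rewrite setDUl setDv set0U; apply/setDidPl.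
  by rewrite disjoint_sym.
by apply: PU; rewrite ?eA ?subsetUl.
Qed.

Lemma blowup_forest_sub A M E : blowup_forest A M E ->
  M \subset A /\ E \subset setX A A.
Proof.
elim/blowup_forest_tree_ind=> [|D B M1 E1 A2 M2 E2 B0 BD _ _ [sM1 sE1] _ [sM2 sE2]].
  by rewrite !sub0set.
split; first exact: setUSS.
have DA : D :\: B \subset D by apply: subsetDl.
apply/subsetP => -[x y]; rewrite !inE /=.
have inA z : z \in B \/ z \in M1 -> (z \in D) || (z \in A2).
  by case=> [/(subsetP BD)->|/(subsetP sM1)/(subsetP DA)->].
case/orP=> [/orP[/(subsetP sE1)|]|/(subsetP sE2)].
- by rewrite !inE => /andP[/andP[_ ->] /andP[_ ->]].
- case/andP=> _ /orP[] /andP[zB /orP zM]; rewrite (inA _ zM) (inA _ (or_introl zB)) //.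
- by rewrite !inE /= => /andP[-> ->]; rewrite !orbT.
Qed.

Lemma blowup_forest_sym A M E : blowup_forest A M E ->
  (forall x y, (x, y) \in E -> (y, x) \in E) /\ (forall x, (x, x) \notin E).
Proof.
elim/blowup_forest_tree_ind=> [|D B M1 E1 A2 M2 E2 B0 BD _ _ [s1 i1] _ [s2 i2]].
  by split=> [x y|x]; rewrite inE.
split=> [x y|x].
  rewrite !inE /= => /orP[/orP[/s1->|/andP[nxy]]|/s2->]; rewrite ?orbT //.
  by rewrite eq_sym orbC => ->; rewrite nxy orbT.
by rewrite !inE /= eqxx !negb_or i1 i2.
Qed.

Lemma blowup_forest_roots0 A E : blowup_forest A set0 E -> A = set0.
Proof.
move Em : set0 => M F; case: F Em => // B ? ? ? ? M2 ? B0 _ _ _ _ /esym/eqP.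
by rewrite setU_eq0 (negbTE B0).
Qed.

(** The adjacency relation of a set of pairs. *)
Definition pair_rel E : rel V := fun x y => (x, y) \in E.

Lemma connect_pairS E E' x y :
  E \subset E' -> connect (pair_rel E) x y -> connect (pair_rel E') x y.
Proof.
move=> sEE; apply: connect_sub => a b ab.
by apply: connect1; apply: (subsetP sEE).
Qed.

Lemma blowup_forest_connect A M E x : blowup_forest A M E -> x \in A ->
  exists2 m, m \in M & connect (pair_rel E) x m.
Proof.
move=> F; elim/blowup_forest_tree_ind: F x => {A M E}
  [|D B M1 E1 A2 M2 E2 B0 BD dDA F1 IH1 F2 IH2] x; first by rewrite inE.
have s1 : attach B M1 E1 \subset attach B M1 E1 :|: E2 by apply: subsetUl.
rewrite inE => /orP[xD|/IH2[m mM c]]; last first.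
  exists m; first by rewrite inE mM orbT.
  by apply: connect_pairS c; apply: subsetUr.
have [xB|xB] := boolP (x \in B); first by exists x; rewrite ?inE ?xB.
have /IH1[m mM c] : x \in D :\: B by rewrite inE xB.
have /set0Pn[b bB] := B0.
exists b; first by rewrite inE bB.
apply: connect_pairS s1 _; apply: (connect_trans (y := m)).
  by apply: connect_pairS c; apply: subsetUl.
apply: connect1; rewrite /pair_rel !inE /= bB mM !orbT andbT.
suff -> : m != b by rewrite orbT.
have [/subsetP/(_ m mM) + _] := blowup_forest_sub F1; rewrite inE => /andP[mB _].
by apply: contraNneq mB => ->.
Qed.

Lemma blowup_tree_forest D B E : blowup_tree D B E -> blowup_forest D B E.
Proof.
move=> T.
have dD0 : [disjoint D & set0] by rewrite -setI_eq0 setI0.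
by have := blowup_forest_tree T dD0 blowup_forest0; rewrite !setU0.
Qed.

Lemma blowup_tree_clique D B E x y :
  blowup_tree D B E -> x \in B -> y \in B -> x != y -> (x, y) \in E.
Proof.
by case=> M1 [E1 [_ _ _ ->]] xB yB nxy; rewrite !inE /= nxy xB yB orbT.
Qed.

Lemma blowup_tree_connect D B E x y :
  blowup_tree D B E -> x \in D -> y \in D -> connect (pair_rel E) x y.
Proof.
move=> T xD yD; have F := blowup_tree_forest T.
have [s _] := blowup_forest_sym F.
have csym : connect_sym (pair_rel E).
  by apply: sym_connect_sym => a b; apply/idP/idP => /s.
have [a aB xa] := blowup_forest_connect F xD.
have [b bB yb] := blowup_forest_connect F yD.
apply: connect_trans xa _; rewrite csym; apply: connect_trans yb _.
have [->|nab] := eqVneq b a; first exact: connect0.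
by apply: connect1; apply: (blowup_tree_clique T).
Qed.

(** The tree that contains a given vertex can be taken as the first one. *)
Lemma blowup_forest_pick A M E v : blowup_forest A M E -> v \in A ->
  exists D B E' M2 E2, [/\ blowup_tree D B E', v \in D, D \subset A,
    blowup_forest (A :\: D) M2 E2 & M = B :|: M2 /\ E = E' :|: E2].
Proof.
move=> F; elim/blowup_forest_tree_ind: F => {A M E}
  [|D B M1 E1 A2 M2 E2 B0 BD dDA F1 IH1 F2 IH2]; first by rewrite inE.
have T : blowup_tree D B (attach B M1 E1) by exists M1, E1.
have eA : (D :|: A2) :\: D = A2.
  by rewrite setDUl setDv set0U; apply/setDidPl; rewrite disjoint_sym.
rewrite inE; have [vD _|vD /= /IH2] := boolP (v \in D).
  by exists D, B, (attach B M1 E1), M2, E2; rewrite eA subsetUl.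
case=> D' [B' [E' [M3 [E3 [T' vD' sD' F3 [-> ->]]]]]].
exists D', B', E', (B :|: M3), (attach B M1 E1 :|: E3).
have dDD : [disjoint D & D'] by apply: disjointWr sD' dDA.
split=> //.
- by apply: subset_trans sD' (subsetUr _ _).
- have -> : (D :|: A2) :\: D' = D :|: A2 :\: D'.
    rewrite setDUl; congr (_ :|: _); apply/setDidPl => //.
  apply: blowup_forest_tree => //.
  by apply: disjointWr (subsetDl _ _) dDA.
- by rewrite !(setUCA B) !(setUCA (attach _ _ _)).
Qed.

(** * Counting blow-up forests *)

Lemma setU_inj (T : finType) (S X1 X2 Y1 Y2 : {set T}) :
    X1 \subset S -> Y1 \subset S -> [disjoint X2 & S] -> [disjoint Y2 & S] ->
  X1 :|: X2 = Y1 :|: Y2 -> X1 = Y1 /\ X2 = Y2.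
Proof.
move=> /setIidPl sX /setIidPl sY dX dY e; split.
  have := congr1 (fun Z => Z :&: S) e; rewrite !setIUl sX sY.
  by rewrite (disjoint_setI0 dX) (disjoint_setI0 dY) !setU0.
have := congr1 (fun Z => Z :\: S) e; rewrite !setDUl.
move: sX sY => /setIidPl; rewrite -setD_eq0 => /eqP-> /setIidPl.
rewrite -setD_eq0 => /eqP->; rewrite !set0U.
by rewrite (setDidPl dX) (setDidPl dY).
Qed.

(** The forest of the children is recovered from the tree and its root block:
    M is the neighbourhood of B, and E is the graph outside B. *)
Lemma attach_inj A B M E M' E' :
    B != set0 -> [disjoint A & B] ->
    M \subset A -> M' \subset A -> E \subset setX A A -> E' \subset setX A A ->
  attach B M E = attach B M' E' -> M = M' /\ E = E'.
Proof.
move=> /set0Pn[b bB] dAB.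
have nB x : x \in A -> x \notin B by move=> xA; rewrite (disjointFr dAB).
suff sub (N : {set V}) (F : {set V * V}) (N' : {set V}) (F' : {set V * V}) :
    N \subset A -> N' \subset A -> F \subset setX A A ->
    F' \subset setX A A -> attach B N F = attach B N' F' ->
    N \subset N' /\ F \subset F'.
  move=> sM sM' sE sE' e.
  have [? ?] := sub _ _ _ _ sM sM' sE sE' e.
  have [? ?] := sub _ _ _ _ sM' sM sE' sE (esym e).
  by split; apply/eqP; rewrite eqEsubset; apply/andP.
move=> sN sN' sF sF' /setP e; split; apply/subsetP; [move=> x xN|case=> x y xyF].
  have xB := nB _ (subsetP sN _ xN).
  have := e (b, x); rewrite !inE /= bB xN (negbTE xB) !orbT /= andbT orbF.
  have -> : b != x by apply: contraNneq xB => <-.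
  rewrite orbT /= => /esym/orP[/(subsetP sF')|//].
  by rewrite !inE /= => /andP[/nB]; rewrite bB.
have := subsetP sF _ xyF; rewrite !inE /= => /andP[/nB xB /nB yB].
have := e (x, y); rewrite !inE /= xyF (negbTE xB) (negbTE yB) /=.
by rewrite andbF orbF.
Qed.

Lemma counted_blowup_tree_at D B : B != set0 -> B \subset D ->
    counted (fun p : {set V} * {set V * V} => blowup_forest (D :\: B) p.1 p.2)
      (forest_num #|D :\: B|) ->
  counted (blowup_tree D B) (forest_num #|D :\: B|).
Proof.
move=> B0 BD c.
apply: counted_ext (counted_image (f := fun p => attach B p.1 p.2) _ c).
  move=> E; split=> [[[M1 E1] F ->]|[M1 [E1 [_ _ F ->]]]]; first by exists M1, E1.
  by exists (M1, E1).
move=> [M1 E1] [M2 E2] /= /blowup_forest_sub[? ?] /blowup_forest_sub[? ?].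
have dDB : [disjoint D :\: B & B] by rewrite -setI_eq0 setIDAC -setIDA setDv setI0.
by case/(attach_inj B0 dDB) => // -> ->.
Qed.

Lemma counted_blowup_tree D :
    (forall A, A \proper D ->
      counted (fun p : {set V} * {set V * V} => blowup_forest A p.1 p.2)
        (forest_num #|A|)) ->
  counted (fun p : {set V} * {set V * V} => blowup_tree D p.1 p.2)
    (rooted_num #|D|).
Proof.
move=> cF.
have -> : rooted_num #|D| = \sum_(A <- enum (powerset D))
    (if #|A| == #|D| then 0 else forest_num #|A|).
  rewrite (sum_subset D (fun i => if i == #|D| then 0 else forest_num i)).
  rewrite big_ord_recr /= eqxx muln0 addn0; apply: eq_bigr => i _.
  by rewrite ltn_eqF.
pose Q A (p : {set V} * {set V * V}) := p.1 = D :\: A /\ blowup_tree D p.1 p.2.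
apply: counted_ext (counted_bigU (Q := Q) _ _ _).
- move=> [B E]; split=> [[A _ []//]|/= T]; exists (D :\: B).
    by rewrite mem_enum inE subsetDl.
  by split=> //=; case: T => ? [? [_ BD _ _]]; rewrite setDDr setDv set0U; apply/esym/setIidPr.
- exact: enum_uniq.
- move=> A; rewrite mem_enum inE => AD.
  have eA : D :\: (D :\: A) = A by rewrite setDDr setDv set0U; apply/setIidPr.
  case: ifPn => [cA|ncA].
    have eAD : A = D by apply/eqP; rewrite eqEcard AD (eqP cA) leqnn.
    apply: counted_none => -[B E] [/= eB [? [? []]]].
    by rewrite eB eAD setDv eqxx.
  have pA : A \proper D by rewrite properEcard AD ltn_neqAle ncA subset_leq_card.
  have B0 : D :\: A != set0 by rewrite setD_eq0; case/andP: pA.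
  have := counted_blowup_tree_at B0 (subsetDl D A).
  rewrite eA => /(_ (cF A pA)) c.
  apply: counted_ext (counted_image (f := fun E => (D :\: A, E)) _ c).
    move=> [B E]; split=> [[E' T [-> ->]]|[/= -> T]]; first by split.
    by exists E.
  by move=> E E' _ _ [].
- move=> A A' + + p [+ _] [+ _]; rewrite !mem_enum !inE => /setIidPr sA /setIidPr sA' -> e.
  by move/(congr1 (setD D)): e; rewrite !setDDr setDv !set0U sA sA'.
Qed.

Lemma pair_connect_closed D E1 E2 x y :
    E1 \subset setX D D -> E2 \subset setX (~: D) (~: D) ->
  connect (pair_rel (E1 :|: E2)) x y -> (x \in D) = (y \in D).
Proof.
move=> s1 s2; apply: closed_connect => a b.
rewrite /pair_rel inE => /orP[/(subsetP s1)|/(subsetP s2)]; rewrite !inE /=.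
  by case/andP=> -> ->.
by case/andP=> /negbTE-> /negbTE->.
Qed.

(** The vertex set of the tree that contains v is the connected component of v,
    hence it depends on the graph only; this is one of the two inclusions. *)
Lemma component_sub A v D B E1 M2 E2 D' B' E1' M2' E2' :
    blowup_tree D B E1 -> v \in D ->
    blowup_tree D' B' E1' -> v \in D' -> blowup_forest (A :\: D') M2' E2' ->
    E1 :|: E2 = E1' :|: E2' ->
  D \subset D'.
Proof.
move=> T vD T' vD' F' e; apply/subsetP => x xD.
have c := connect_pairS (subsetUl E1 E2) (blowup_tree_connect T vD xD).
rewrite e in c; rewrite -(pair_connect_closed _ _ c) //.
  by have [] := blowup_forest_sub (blowup_tree_forest T').
have [_ s] := blowup_forest_sub F'; apply: subset_trans s _.
by apply/subsetP => -[a b]; rewrite !inE /= => /andP[/andP[-> _] /andP[-> _]].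
Qed.

(** Recurrence over the tree that contains a chosen vertex v; the set Z below
    consists of the other vertices of this tree. *)
Lemma counted_blowup_forest A :
  counted (fun p : {set V} * {set V * V} => blowup_forest A p.1 p.2)
    (forest_num #|A|).
Proof.
move En : #|A| => n; elim/ltn_ind: n A En => n IHn A En.
have [A0|[v vA]] := set_0Vmem A.
  rewrite -En A0 cards0; apply: (counted_one (x0 := (set0, set0))) => -[M E] /=.
  split=> [F|[-> ->]]; last exact: blowup_forest0.
  have := blowup_forest_sub F; rewrite !subset0 => -[/eqP-> /subsetP sE].
  by congr (_, _); apply/setP => p; rewrite inE; apply/negP => /sE; rewrite !inE.
have EA : #|A| = #|A :\ v|.+1 by rewrite (cardsD1 v A) vA.
case: n IHn En => [|n] IHn En; first by rewrite En in EA.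
have En' : #|A :\ v| = n by move: EA; rewrite En => -[].
pose P Z (q : ({set V} * {set V * V}) * ({set V} * {set V * V})) :=
  blowup_tree (v |: Z) q.1.1 q.1.2 /\ blowup_forest (A :\: (v |: Z)) q.2.1 q.2.2.
pose f (q : ({set V} * {set V * V}) * ({set V} * {set V * V})) :=
  (q.1.1 :|: q.2.1, q.1.2 :|: q.2.2).
pose Q Z (p : {set V} * {set V * V}) := exists2 q, P Z q & p = f q.
rewrite forest_numS -En'.
rewrite -(sum_subset (A :\ v) (fun j => rooted_num j.+1 * forest_num (#|A :\ v| - j))).
have sub Z : Z \in enum (powerset (A :\ v)) -> v |: Z \subset A.
  by rewrite mem_enum inE subsetD1 subUset sub1set vA => /andP[].
have vNZ Z : Z \in enum (powerset (A :\ v)) -> v \notin Z.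
  by rewrite mem_enum inE subsetD1 => /andP[].
have cZ Z : Z \in enum (powerset (A :\ v)) -> #|v |: Z| = #|Z|.+1.
  by move=> /vNZ vZ; rewrite cardsU1 vZ.
apply: counted_ext (counted_bigU (Q := Q) _ _ _).
- move=> [M E]; split.
    case=> Z /sub ZA [[[B E1] [M2 E2]] [/= T F] [-> ->]].
    have <- : v |: Z :|: A :\: (v |: Z) = A.
      apply/setP => x; rewrite in_setU in_setD.
      by have [/(subsetP ZA)->|//] := boolP (x \in v |: Z).
    apply: blowup_forest_tree => //.
    by rewrite -setI_eq0 setIDA setIC -setIDA setDv setI0.
  move=> /= F; have [D [B [E1 [M2 [E2 [T vD DA F2 [-> ->]]]]]]] :=
    blowup_forest_pick F vA.
  exists (D :\ v); first by rewrite mem_enum inE setSD.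
  by exists ((B, E1), (M2, E2)) => //; rewrite /P setD1K.
- exact: enum_uniq.
- move=> Z ZA; apply: counted_image; last first.
    apply: (@counted_pair _ _
      (fun p : {set V} * {set V * V} => blowup_tree (v |: Z) p.1 p.2)
      (fun p : {set V} * {set V * V} => blowup_forest (A :\: (v |: Z)) p.1 p.2)).
      rewrite -cZ //; apply: counted_blowup_tree => W WD; apply: IHn => //.
      by rewrite -En; apply: leq_trans (proper_card WD) (subset_leq_card (sub _ ZA)).
    have cD : #|A :\: (v |: Z)| = #|A :\ v| - #|Z|.
      by rewrite cardsDS ?sub // EA cZ // subSS.
    by apply: IHn cD; rewrite En' ltnS leq_subr.
  move=> [[B E1] [M2 E2]] [[B' E1'] [M2' E2']] [/= T F] [/= T' F'] [eM eE].
  have [sB sE1] := blowup_forest_sub (blowup_tree_forest T).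
  have [sB' sE1'] := blowup_forest_sub (blowup_tree_forest T').
  have [sM2 sE2] := blowup_forest_sub F.
  have [sM2' sE2'] := blowup_forest_sub F'.
  have dD : [disjoint A :\: (v |: Z) & v |: Z].
    by rewrite -setI_eq0 setIDAC -setIDA setDv setI0.
  have dX : [disjoint setX (A :\: (v |: Z)) (A :\: (v |: Z)) & setX (v |: Z) (v |: Z)].
    rewrite -setI_eq0; apply/eqP/setP => -[x y]; rewrite !in_setI !in_setX in_set0 /=.
    by have [xA|//] := boolP (x \in A :\: (v |: Z)); rewrite (disjointFr dD) ?andbF.
  have [-> ->] := setU_inj sB sB' (disjointWl sM2 dD) (disjointWl sM2' dD) eM.
  by have [-> ->] := setU_inj sE1 sE1' (disjointWl sE2 dX) (disjointWl sE2' dX) eE.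
- move=> Z W ZA WA p [[[B E1] [M2 E2]] [/= T F] ->].
  case=> [[[B' E1'] [M2' E2']] [/= T' F']] [eM eE].
  have vU (X : {set V}) : v \in v |: X by rewrite setU11.
  have eD : v |: Z = v |: W.
    apply/eqP; rewrite eqEsubset; apply/andP; split.
      exact: component_sub T (vU _) T' (vU _) F' eE.
    exact: component_sub T' (vU _) T (vU _) F (esym eE).
  by rewrite -(setU1K (vNZ _ ZA)) -(setU1K (vNZ _ WA)) eD.
Qed.

(** * Recovering the root block *)

(** The complete graph on A. *)
Definition complete_pairs A : {set V * V} :=
  [set p | [&& p.1 != p.2, p.1 \in A & p.2 \in A]].

Lemma attach_complete D B : B \subset D ->
  attach B (D :\: B) (complete_pairs (D :\: B)) = complete_pairs D.
Proof.
move=> BD; apply/setP => -[x y]; rewrite !inE /=.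
have [->|_] := eqVneq x y; first by rewrite ?andbF.
have [/(subsetP BD)->|_] /= := boolP (x \in B);
  have [/(subsetP BD)->|_] //= := boolP (y \in B); rewrite ?orbF ?orbT ?andbT ?andbF //.
Qed.

(** Any nonempty B is a root block of the complete graph; the rest, if not empty,
    is the single other block. *)
Lemma complete_blowup_tree D B :
  B != set0 -> B \subset D -> blowup_tree D B (complete_pairs D).
Proof.
move=> B0 BD.
suff F (A : {set V}) : blowup_forest A A (complete_pairs A).
  by exists (D :\: B), (complete_pairs (D :\: B)); rewrite attach_complete.
have [->|A0] := eqVneq A set0.
  have -> : complete_pairs set0 = set0 by apply/setP => p; rewrite !inE !andbF.
  exact: blowup_forest0.
apply: blowup_tree_forest; exists set0, set0; split=> //.
  rewrite setDv; exact: blowup_forest0.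
apply/setP => -[x y]; rewrite !inE /= orbF.
by case: (x \in A); case: (y \in A).
Qed.

(** If the closed neighbourhood of a root vertex x is the whole set of root
    vertices, then there is only one tree, and it has only one block. *)
Lemma blowup_forest_twin A M E x : blowup_forest A M E -> x \in M ->
    (forall y, y \in M -> y != x -> (x, y) \in E) ->
    (forall y, (x, y) \in E -> y \in M) ->
  M = A /\ E = complete_pairs A.
Proof.
move=> F; elim/blowup_forest_tree_ind: F x => {A M E}
  [|D B M1 E1 A2 M2 E2 B0 BD dDA F1 _ F2 _] x; first by rewrite inE.
have [sM1 sE1] := blowup_forest_sub F1.
have [sM2 sE2] := blowup_forest_sub F2.
have notE (y z : V) : y \in D -> z \in A2 ->
    (y, z) \notin attach B M1 E1 :|: E2 /\ (z, y) \notin attach B M1 E1 :|: E2.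
  move=> yD zA; have yA : y \notin A2 by rewrite (disjointFr dDA).
  have zD : z \notin D by rewrite (disjointFl dDA).
  have zB : z \notin B by apply: contra zD => /(subsetP BD).
  have zM : z \notin M1 by apply: contra zD => /(subsetP sM1); rewrite inE => /andP[].
  have nE1 u w : u \notin D \/ w \notin D -> (u, w) \notin E1.
    move=> nD; apply/negP => /(subsetP sE1); rewrite !inE /= => /andP[/andP[_ uD] /andP[_ wD]].
    by case: nD; rewrite ?uD ?wD.
  have nE2 u w : u \notin A2 \/ w \notin A2 -> (u, w) \notin E2.
    move=> nD; apply/negP => /(subsetP sE2); rewrite !inE /= => /andP[uD wD].
    by case: nD; rewrite ?uD ?wD.
  rewrite !inE /= (negbTE zB) (negbTE zM) !andbF /= !orbF !negb_or.
  by rewrite !nE1 ?nE2; auto.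
rewrite inE => /orP[xB|xM2] adj nadj; last first.
  have /set0Pn[b bB] := B0.
  have [_] := notE b x (subsetP BD _ bB) (subsetP sM2 _ xM2).
  rewrite adj ?inE ?bB //; apply: contraTneq xM2 => <-.
  apply/negP => /(subsetP sM2); rewrite (disjointFr dDA) //; exact: (subsetP BD).
have xD := subsetP BD _ xB.
have M20 : M2 = set0.
  apply/setP => y; rewrite inE; apply/negP => yM2.
  have yA := subsetP sM2 _ yM2.
  have [+ _] := notE x y xD yA.
  rewrite adj ?inE ?yM2 ?orbT //; apply: contraTneq yA => ->.
  by rewrite (disjointFr dDA).
have A20 : A2 = set0 by apply: (@blowup_forest_roots0 _ E2); rewrite -M20.
have E20 : E2 = set0.
  by apply/eqP; rewrite -subset0; apply/subsetP => p /(subsetP sE2); rewrite A20 !inE.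
have M10 : M1 = set0.
  apply/setP => y; rewrite inE; apply/negP => yM1.
  have := subsetP sM1 _ yM1; rewrite inE => /andP[yB yD].
  have : y \in B :|: M2.
    apply: nadj; rewrite !inE /= xB yM1 orbT /= andbT.
    have -> : x != y by apply: contraNneq yB => <-.
    by rewrite orbT.
  by rewrite M20 setU0 (negbTE yB).
have DB0 : D :\: B = set0 by apply: (@blowup_forest_roots0 _ E1); rewrite -M10.
have eD : D = B by apply/eqP; rewrite eqEsubset BD -setD_eq0 DB0 eqxx.
have E10 : E1 = set0.
  by apply/eqP; rewrite -subset0; apply/subsetP => p /(subsetP sE1); rewrite DB0 !inE.
rewrite M20 A20 eD setU0; split=> //.
apply/setP => -[a b]; rewrite E10 E20 M10 !inE /= orbF.
by case: (a \in B); case: (b \in B); rewrite ?andbF ?andbT.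
Qed.

Lemma attach_nbr D B M E x y : E \subset setX (D :\: B) (D :\: B) -> x \in B ->
  ((x, y) \in attach B M E) = (x != y) && (y \in B :|: M).
Proof.
move=> sE xB; rewrite !inE /= xB orTb /=.
have /negbTE-> : (x, y) \notin E.
  by apply/negP => /(subsetP sE); rewrite !inE /= xB.
by case: (y \in B) => //=; rewrite !orbF.
Qed.

(** A vertex y of the block B' outside the block B is a twin of x, so it lies in
    a child block of B and [blowup_forest_twin] applies to the forest of the
    children: there is one child, without children of its own, and the graph
    is complete. *)
Lemma blowup_tree_block_uniq D B B' E x :
    blowup_tree D B E -> blowup_tree D B' E -> E <> complete_pairs D ->
  x \in B -> x \in B' -> B = B'.
Proof.
move=> T T' nE; suff sub C C' : blowup_tree D C E -> blowup_tree D C' E ->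
    x \in C -> x \in C' -> C' \subset C.
  by move=> xB xB'; apply/eqP; rewrite eqEsubset (sub _ _ T' T) // (sub _ _ T T').
case=> M1 [E1 [_ CD F eE]] [M1' [E1' [_ _ F' eE']]] xC xC'.
have [_ sE1] := blowup_forest_sub F; have [_ sE1'] := blowup_forest_sub F'.
have nbr y z : y \in C -> ((y, z) \in E) = (y != z) && (z \in C :|: M1).
  by move=> yC; rewrite eE (attach_nbr _ _ sE1).
have nbr' y z : y \in C' -> ((y, z) \in E) = (y != z) && (z \in C' :|: M1').
  by move=> yC; rewrite eE' (attach_nbr _ _ sE1').
have eU : C :|: M1 = C' :|: M1'.
  apply/setP => y; have [<-|nxy] := eqVneq x y; first by rewrite !inE xC xC'.
  by have := nbr _ y xC; rewrite nbr' // nxy /= => <-.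
apply/subsetP => y yC'; apply: contraPT nE => yC; apply.
have yM1 : y \in M1.
  have : y \in C :|: M1 by rewrite eU inE yC'.
  by rewrite inE (negbTE yC).
have inE1 z : z \notin C -> ((y, z) \in E1) = ((y, z) \in E).
  by move=> zC; rewrite eE !inE /= (negbTE zC) (negbTE yC) /= andbF orbF.
have [||eM eE1] := blowup_forest_twin F yM1.
- move=> z zM1 nzy; have zC : z \notin C.
    have [sM1 _] := blowup_forest_sub F.
    by have := subsetP sM1 _ zM1; rewrite inE => /andP[].
  by rewrite inE1 // nbr' // eq_sym nzy -eU inE zM1 orbT.
- move=> z yz; have zC : z \notin C.
    by have := subsetP sE1 _ yz; rewrite !inE => /andP[_ /andP[]].
  move: yz; rewrite inE1 // nbr' // -eU => /andP[_].
  by rewrite inE (negbTE zC).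
by rewrite eE eM eE1 attach_complete.
Qed.
End Forests.

(** * Rooted trees as parent maps *)

Section ParentMaps.
Variable N : finType.
Implicit Types (par : N -> option N) (rk : N -> nat) (t : rel N).

(** Adjacency in the rooted forest with parent map [par]; the roots are the
    elements without a parent. *)
Definition parent_rel par : rel N :=
  fun x y => (par x == Some y) || (par y == Some x).

(** The rank decreases from a node to its parent, so a parent map with a rank
    has no cycle. *)
Definition ranked par rk := forall x y, par x = Some y -> rk y < rk x.

Lemma parent_rel_sym par : symmetric (parent_rel par).
Proof. by move=> x y; rewrite /parent_rel orbC. Qed.

(** On a cycle, both neighbours of an element of maximal rank would have to be
    its parent. *)
Lemma parent_tree par rk root :
    ranked par rk -> par root = None -> (forall x, par x = None -> x = root) ->
  is_tree (parent_rel par).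
Proof.
move=> rkP par0 root_uniq.
have to_root x : connect (parent_rel par) x root.
  move En : (rk x) => n; elim/ltn_ind: n x En => n IHn x En.
  case Ep: (par x) => [y|]; last by rewrite (root_uniq _ Ep) connect0.
  apply: (connect_trans (y := y)); first by apply: connect1; rewrite /parent_rel Ep eqxx.
  by apply: IHn (erefl _); rewrite -En; apply: rkP.
split.
- exact: parent_rel_sym.
- move=> x; rewrite /parent_rel orbb; apply/eqP => /rkP.
  by rewrite ltnn.
- split; first by apply/card_gt0P; exists root.
  move=> x y; apply: connect_trans (to_root x) _.
  by rewrite (sym_connect_sym (@parent_rel_sym par)).
move=> c uc; rewrite leqNgt; apply/negP => c3.
have [x0 x0c] : exists x, x \in c by case: c c3 {uc} => // x c; exists x; rewrite mem_head.
have [x xc maxx] := @arg_maxnP _ x0 (mem c) rk x0c.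
have [i s es] := rot_to xc.
have : ucycle (parent_rel par) (x :: s) by rewrite -es rot_ucycle.
have sz : size s >= 2 by rewrite -ltnS -[(size s).+1]/(size (x :: s)) -es size_rot.
have ins y : y \in s -> rk y <= rk x.
  by move=> ys; apply: maxx; rewrite /= -(mem_rot i) es inE ys orbT.
case: s sz ins {es} => [|y [|z s]] // _ ins /andP[/=].
rewrite rcons_path /= => /and3P[xy yz /andP[_ zx]] /and3P[_ yNs _].
have up u : u \in [:: y, z & s] -> parent_rel par x u -> par x = Some u.
  by move=> /ins us /orP[/eqP//|/eqP/rkP]; rewrite ltnNge us.
have lasts : last z s \in z :: s by apply: mem_last.
have : par x = Some y by apply: up xy; rewrite mem_head.
have -> : par x = Some (last z s).
  by apply: up; rewrite 1?parent_rel_sym // inE lasts orbT.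
by case=> ey; rewrite -ey lasts in yNs.
Qed.

(** The parent of x is a neighbour nearer to the root.  An edge of t that does
    not join a node to its parent would close a cycle with the path between its
    ends along parents. *)
Lemma tree_parent t root : is_tree t ->
  exists par rk, [/\ ranked par rk, par root = None & t =2 parent_rel par].
Proof.
move=> [tsym tirr [_ tconn] tacyc].
pose reach x n := [exists p : n.-tuple N, path t root p && (last root p == x)].
have reach_path p : path t root p -> reach (last root p) (size p).
  by move=> pp; apply/existsP; exists (in_tuple p); rewrite /= pp eqxx.
have ex x : exists n, reach x n.
  by have /connectP[p pp ->] := tconn root x; exists (size p); apply: reach_path.
pose d x := ex_minn (ex x).
have d_le p : path t root p -> d (last root p) <= size p.
  by move=> /reach_path; rewrite /d; case: ex_minnP => m _; apply.
have d_path x : exists p, [/\ path t root p, last root p = x & size p = d x].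
  rewrite /d; case: ex_minnP => m /existsP[p /andP[pp /eqP lp]] _.
  by exists p; rewrite size_tuple.
pose par x := if x == root then None else [pick y | t y x && (d y < d x)].
have parP x y : par x = Some y -> t y x /\ d y < d x.
  by rewrite /par; case: eqP => // _; case: pickP => // z /andP[? ?] [<-].
have par_ex x : x != root -> exists y, par x = Some y.
  move=> nx; rewrite /par (negbTE nx); case: pickP => [y _|no]; first by exists y.
  have [p [pp lp sp]] := d_path x.
  case/lastP: p pp lp sp => [_ ex0|p y]; first by rewrite -ex0 eqxx in nx.
  rewrite rcons_path last_rcons size_rcons => /andP[pp ly] ey sp.
  by have := no (last root p); rewrite -ey ly /= ey -sp ltnS d_le.
have sub x y : parent_rel par x y -> t x y.
  by case/orP=> /eqP/parP[]; rewrite // tsym.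
have psym := sym_connect_sym (@parent_rel_sym par).
have to_root x : connect (parent_rel par) x root.
  move En : (d x) => n; elim/ltn_ind: n x En => n IHn x En.
  have [->|/par_ex[y Ep]] := eqVneq x root; first exact: connect0.
  have [_ lt] := parP _ _ Ep.
  apply: (connect_trans (y := y)); first by apply: connect1; rewrite /parent_rel Ep eqxx.
  by apply: IHn (erefl _); rewrite -En.
exists par, d; split; first by move=> x y /parP[].
  by rewrite /par eqxx.
move=> x y; apply/idP/idP => [txy|]; last exact: sub.
apply/negPn/negP => npxy.
have /connectP[p0 pp0 lp0] : connect (parent_rel par) y x.
  by apply: connect_trans (to_root y) _; rewrite psym.
case/shortenP: pp0 lp0 => p pp up _ lp.
have /tacyc : ucycle t (y :: p).
  rewrite /ucycle up andbT /= rcons_path -lp txy andbT.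
  by apply: sub_path pp => a b; apply: sub.
case: p pp up lp => [|z [|w p]] //=.
  by move=> _ _ exy; rewrite exy tirr in txy.
by rewrite andbT => pyz _ ex0; rewrite ex0 parent_rel_sym pyz in npxy.
Qed.
End ParentMaps.

(** * Distances between leaves *)

Section Distance.
Variables (W : finType) (t : rel W).

(** Connectedness of x and y excludes the default value #|W|. *)
Lemma gdist_leP k x y : connect t x y ->
  reflect (exists p, [/\ path t x p, last x p = y & size p <= k])
          (gdist t x y <= k).
Proof.
set a := fun k => [exists p : k.-tuple W, path t x p && (last x p == y)].
rewrite /gdist -/a => cxy.
have small p : path t x p -> last x p = y ->
    exists q : seq W, [/\ a (size q), size q <= size p & size q < #|W|].
  move=> pp; case/shortenP: pp => q pq uq sq lq; exists q; split.
  - by apply/existsP; exists (in_tuple q); rewrite /= pq lq eqxx.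
  - by apply: uniq_leq_size sq; case/andP: uq.
  - by have := max_card (mem (x :: q)); rewrite (card_uniqP uq).
apply: (iffP idP) => [le_k|[p [pp lp sp]]].
  have has_a : has a (iota 0 #|W|).
    have /connectP[p pp /esym lp] := cxy; have [q [aq _ lt]] := small p pp lp.
    by apply/hasP; exists (size q); rewrite // mem_iota.
  have := nth_find 0 has_a; move: (has_a); rewrite has_find size_iota => lt.
  rewrite nth_iota // add0n => /existsP[p /andP[pp /eqP lp]].
  by exists p; rewrite size_tuple.
have [q [aq le_q lt_q]] := small p pp lp.
apply: leq_trans (leq_trans le_q sp); rewrite leqNgt; apply/negP => lt.
by have := before_find 0 lt; rewrite nth_iota // add0n aq.
Qed.

Lemma leaf_dist_le3 x y a b :
    symmetric t -> connect t x y -> x != y -> t x =1 pred1 a -> t y =1 pred1 b ->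
  (gdist t x y <= 3) = (a == b) || t a b.
Proof.
move=> tsym cxy nxy xa yb; apply/(gdist_leP _ cxy)/idP; last first.
  have txa : t x a by rewrite xa /= eqxx.
  have tby : t b y by rewrite tsym yb /= eqxx.
  case/orP=> [/eqP eab|tab]; first by exists [:: a; y]; rewrite /= txa eab tby.
  by exists [:: a; b; y]; rewrite /= txa tab tby.
case=> -[|u [|v [|w [|? p]]]] [//= pp lp _].
- by rewrite lp eqxx in nxy.
- move: pp; rewrite andbT lp => txy.
  have ea : y = a by apply/eqP; rewrite -[_ == _]xa.
  have eb : x = b by apply/eqP; rewrite -[_ == _]yb tsym.
  by rewrite -ea -eb tsym txy orbT.
- case/and3P: pp => xu uv _; rewrite lp in uv.
  have ea : u = a by apply/eqP; rewrite -[_ == _]xa.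
  have eb : u = b by apply/eqP; rewrite -[_ == _]yb tsym.
  by rewrite -ea -eb eqxx.
- case/and4P: pp => xu uv vw _; rewrite lp in vw.
  have ea : u = a by apply/eqP; rewrite -[_ == _]xa.
  have eb : v = b by apply/eqP; rewrite -[_ == _]yb tsym.
  by rewrite -ea -eb uv orbT.
Qed.
End Distance.

(** * Blow-ups along a map to the nodes of a rooted forest *)

Section Nodes.
Variables (V N : finType) (par : N -> option N) (rk : N -> nat).
Hypothesis rkP : ranked par rk.
Variable nd : V -> N.
Implicit Types S : {set N}.

(** The node a has a parent in S. *)
Definition parent_in S a := if par a is Some b then b \in S else false.

(** The blow-up of the subforest induced on a set S of nodes: [nd x] is the node
    of the vertex x, and the roots of the induced subforest are the nodes of S
    whose parent is not in S. *)
Definition nodes_support S : {set V} := [set x | nd x \in S].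
Definition nodes_roots S : {set V} :=
  [set x | (nd x \in S) && ~~ parent_in S (nd x)].
Definition nodes_pairs S : {set V * V} :=
  [set p | [&& p.1 != p.2, nd p.1 \in S, nd p.2 \in S &
     (nd p.1 == nd p.2) || parent_rel par (nd p.1) (nd p.2)]].

(** Every node of S must carry a vertex, as blocks are nonempty. *)
Lemma nodes_forest S : (forall a, a \in S -> exists x, nd x = a) ->
  blowup_forest (nodes_support S) (nodes_roots S) (nodes_pairs S).
Proof.
move En : #|S| => n; elim/ltn_ind: n S En => n IHn S En onS.
have [S0|[a0 a0S]] := set_0Vmem S.
  have -> : nodes_support S = set0 by apply/setP => x; rewrite S0 !inE.
  have -> : nodes_roots S = set0 by apply/setP => x; rewrite S0 !inE.
  have -> : nodes_pairs S = set0 by apply/setP => x; rewrite S0 !inE andbF.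
  exact: blowup_forest0.
(* An element b of minimal rank is a root; D is the set of its descendants
   within S. *)
have [b bS minb] := @arg_minnP _ a0 (mem S) rk a0S.
have {}bS : b \in S by [].
have bpar : ~~ parent_in S b.
  rewrite /parent_in; case Ep: (par b) => [c|] //; apply/negP => cS.
  by have := rkP Ep; rewrite ltnNge minb.
pose e := [rel x y | (y \in S) && (par y == Some x)].
pose D := [set c in S | connect e b c].
have bD : b \in D by rewrite inE bS connect0.
have Dpar c : c \in D -> c != b -> exists2 d, par c = Some d & d \in D.
  rewrite inE => /andP[cS /connectP[p pp ->]].
  case/lastP: p pp => [|p d]; first by rewrite eqxx.
  rewrite rcons_path last_rcons => /andP[pp /andP[dS /eqP dpar]] _.
  exists (last b p) => //; rewrite inE; apply/andP; split; last first.
    by apply/connectP; exists p.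
  case/lastP: p pp {dpar} => [|p c']; first by [].
  by rewrite rcons_path last_rcons => /andP[_ /andP[]].
have Dchild c d : c \in D -> d \in S -> par d = Some c -> d \in D.
  rewrite !inE => /andP[_ bc] dS pd; rewrite dS /=; apply: connect_trans bc _.
  by apply: connect1; rewrite /= dS pd eqxx.
have DS : D \subset S by apply/subsetP => c; rewrite inE => /andP[].
have bpar' c : par b = Some c -> c \notin S.
  by move=> Ep; move: bpar; rewrite /parent_in Ep.
pose S1 := D :\ b; pose S2 := S :\: D.
have S1S : S1 \subset S by apply: subset_trans (subsetDl _ _) DS.
have F1 := IHn #|S1| _ S1 erefl (fun a aS => onS a (subsetP S1S _ aS)).
have F2 := IHn #|S2| _ S2 erefl (fun a aS => onS a (subsetP (subsetDl _ _) _ aS)).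
have {}F1 : blowup_forest (nodes_support S1) (nodes_roots S1) (nodes_pairs S1).
  apply: F1; rewrite -En (cardsD1 b S) bS ltnS subset_leq_card //.
  exact: setSD.
have {}F2 : blowup_forest (nodes_support S2) (nodes_roots S2) (nodes_pairs S2).
  apply: F2; rewrite -En cardsDS // ltn_subrL (cardsD1 b D) bD.
  by rewrite (cardsD1 b S) bS.
pose B := [set x | nd x == b].
have B0 : B != set0.
  by have [x xb] := onS b bS; apply/set0Pn; exists x; rewrite inE xb.
have dB1 : [disjoint B & nodes_support S1].
  rewrite -setI_eq0; apply/eqP/setP => x; rewrite !inE.
  by case: eqP.
have dB2 : [disjoint B :|: nodes_support S1 & nodes_support S2].
  rewrite -setI_eq0; apply/eqP/setP => x; rewrite !in_setI !in_setU !inE -/D.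
  have [->|_] := eqVneq (nd x) b; rewrite ?bS ?connect0 ?andbF //=.
  by rewrite andbA andbN.
have roots1 c : (c \in S1) && ~~ parent_in S1 c = (c \in S) && (par c == Some b).
  rewrite in_setD1; apply/idP/idP.
    case/andP=> /andP[nc cD]; rewrite /parent_in (subsetP DS _ cD).
    have [d -> dD] := Dpar c cD nc.
    by rewrite in_setD1 dD andbT negbK => /eqP->; rewrite eqxx.
  case/andP=> cS /eqP pc; rewrite (Dchild b c bD cS pc) /parent_in pc.
  rewrite in_setD1 eqxx !andbT; apply/eqP => ecb.
  by have := rkP pc; rewrite ecb ltnn.
have -> : nodes_support S = B :|: nodes_support S1 :|: nodes_support S2.
  apply/setP => x; rewrite !in_setU ![x \in _]inE in_setD1 in_setD.
  have [->|_] /= := eqVneq (nd x) b; first by rewrite bS.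
  by have [/(subsetP DS)->|] := boolP (nd x \in D).
have -> : nodes_roots S = B :|: nodes_roots S2.
  apply/setP => x; rewrite in_setU ![x \in _]inE in_setD.
  have [->|nxb] /= := eqVneq (nd x) b; first by rewrite bS.
  have [xD|xD] /= := boolP (nd x \in D).
    rewrite (subsetP DS _ xD) /parent_in /=.
    by have [d -> /(subsetP DS)->] := Dpar _ xD nxb.
  have [xS|//] /= := boolP (nd x \in S); rewrite /parent_in.
  case Ep: (par (nd x)) => [d|//]; rewrite in_setD.
  suff -> : d \notin D by [].
  by apply: contra xD => dD; apply: Dchild dD xS Ep.
suff -> : nodes_pairs S =
    attach B (nodes_roots S1) (nodes_pairs S1) :|: nodes_pairs S2.
  exact: blowup_forestU.
apply/setP => -[x y]; rewrite /attach !in_setU ![_ \in nodes_pairs _]inE.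
rewrite [(x, y) \in _]inE /= !in_setU ![_ \in B]inE ![_ \in nodes_roots _]inE !roots1.
have [//|_] /= := eqVneq x y.
move: (nd x) (nd y) => c d.
have [cS|cS] := boolP (c \in S); last first.
  have ncb : c == b = false by apply: contraNF cS => /eqP->.
  have cD : (c \in D) = false by apply: contraNF cS => /(subsetP DS).
  by rewrite !in_setD1 !in_setD ncb cD (negbTE cS) !andbF.
have [dS|dS] := boolP (d \in S); last first.
  have ndb : d == b = false by apply: contraNF dS => /eqP->.
  have dD : (d \in D) = false by apply: contraNF dS => /(subsetP DS).
  by rewrite !in_setD1 !in_setD ndb dD (negbTE dS) !andbF.
rewrite !in_setD1 !in_setD cS dS /=.
have nb a : a \in S -> par b == Some a = false.
  by move=> aS; apply/eqP => /bpar'; rewrite aS.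
have [->|ncb] /= := eqVneq c b.
  rewrite bD /= orbF /parent_rel nb //= [b == d]eq_sym.
  by case: (d == b); rewrite ?orbT ?orbF ?andbT //= ?eqxx.
have [->|ndb] /= := eqVneq d b.
  rewrite bD /= !andbF !orbF /parent_rel nb //= !orbF.
  by rewrite (negbTE ncb).
have [cD|cD] /= := boolP (c \in D); have [dD|dD] //= := boolP (d \in D);
  rewrite ?orbF //; apply/negbTE; rewrite !negb_or; apply/and3P; split.
- by apply: contraNneq dD => <-.
- by apply: contra dD => /eqP pc; have [e' + eD] := Dpar _ cD ncb; rewrite pc => -[->].
- by apply: contra dD => /eqP; apply: Dchild cD dS.
- by apply: contraNneq cD => ->.
- by apply: contra cD => /eqP; apply: Dchild dD cS.
- by apply: contra cD => /eqP pd; have [e' + eD] := Dpar _ dD ndb; rewrite pd => -[->].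
Qed.
End Nodes.

(** * Blow-up trees and 3-leaf powers *)

Section LeafPowers.
Variable V : finType.
Implicit Types (A B D M : {set V}) (E : {set V * V}).

(** The forest (A, M, E) is the blow-up, along the partial map [nd] with domain
    A, of the rooted forest on N with parent map [par]. *)
Record node_structure A M E (N : finType) (par : N -> option N) (rk : N -> nat)
    (nd : V -> option N) : Prop := NodeStructure {
  ns_ranked : ranked par rk;
  ns_onto : forall a, exists x, nd x = Some a;
  ns_support : forall x, (x \in A) = (nd x : bool);
  ns_roots : forall x, (x \in M) = if nd x is Some a then par a == None else false;
  ns_pairs : forall x y, ((x, y) \in E) = (x != y) &&
    if nd x is Some a then
      if nd y is Some b then (a == b) || parent_rel par a b else false
    else false }.

Lemma forest_nodes A M E : blowup_forest A M E ->
  exists (N : finType) (par : N -> option N) (rk : N -> nat)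
    (nd : V -> option N), node_structure A M E par rk nd.
Proof.
elim/blowup_forest_tree_ind=> {A M E}
  [|D B M1 E1 A2 M2 E2 B0 BD dDA F1 [N1 [par1 [rk1 [nd1 H1]]]]
    F2 [N2 [par2 [rk2 [nd2 H2]]]]].
  exists void, (fun=> None), (fun=> 0), (fun=> None).
  by split=> [[]|[]|x|x|x y] //; rewrite inE ?andbF.
(* The new node None carries the root block B; it becomes the parent of the
   roots of the first forest. *)
pose N : finType := option (N1 + N2).
pose par (a : N) : option N := match a with
  | None => None
  | Some (inl a1) => Some (omap inl (par1 a1))
  | Some (inr a2) => omap (fun b => Some (inr b)) (par2 a2)
  end.
pose rk (a : N) := match a with
  | None => 0
  | Some (inl a1) => (rk1 a1).+1
  | Some (inr a2) => rk2 a2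
  end.
pose nd x : option N := if x \in B then Some None else
  if nd1 x is Some a1 then Some (Some (inl a1)) else
  if nd2 x is Some a2 then Some (Some (inr a2)) else None.
have ndB x : x \in B -> nd1 x = None /\ nd2 x = None.
  move=> xB; have xD := subsetP BD _ xB.
  have := ns_support H1 x; rewrite inE xB /=; case: (nd1 x) => // _.
  by have := ns_support H2 x; rewrite (disjointFr dDA) //; case: (nd2 x).
have nd12 x a : nd1 x = Some a -> nd2 x = None.
  move=> ex; have := ns_support H1 x; rewrite ex inE => /andP[_ xD].
  by have := ns_support H2 x; rewrite (disjointFr dDA) //; case: (nd2 x).
exists N, par, rk, nd; split.
- move=> [[a|a]|] [[b|b]|] //=; rewrite /par.
  + by case Ep: (par1 a) => [c|] //= [<-]; rewrite ltnS; apply: (ns_ranked H1).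
  + by case: (par1 a).
  + by case: (par2 a).
  + by case Ep: (par2 a) => [c|] //= [<-]; apply: (ns_ranked H2).
  + by case: (par2 a).
- move=> [[a|a]|].
  + have [x ex] := ns_onto H1 a; exists x; rewrite /nd ex.
    by have [/ndB[]|//] := boolP (x \in B); rewrite ex.
  + have [x ex] := ns_onto H2 a; exists x; rewrite /nd ex.
    have [/ndB[_]|_] := boolP (x \in B); first by rewrite ex.
    by case E: (nd1 x) => [b|] //; rewrite (nd12 _ _ E) in ex.
  + by have /set0Pn[x xB] := B0; exists x; rewrite /nd xB.
- move=> x; rewrite inE (ns_support H2) /nd.
  have := ns_support H1 x; rewrite inE.
  have [xB _|xB /= ->] := boolP (x \in B); first by rewrite (subsetP BD).
  by case: (nd1 x) => //; case: (nd2 x).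
- move=> x; rewrite inE (ns_roots H2) /nd.
  have [//|xB] := boolP (x \in B).
  case E: (nd1 x) => [a|]; first by rewrite (nd12 _ _ E).
  by case: (nd2 x) => //= a; case: (par2 a).
move=> x y; rewrite !inE /= (ns_pairs H1) (ns_pairs H2) !(ns_roots H1) /nd.
have [->|_] /= := eqVneq x y; first by [].
have [xB|xB] := boolP (x \in B); have [yB|yB] := boolP (y \in B) => /=.
- by have [-> ->] := ndB x xB.
- have [-> ->] := ndB x xB; case E: (nd1 y) => [a|] /=.
    by rewrite ?(nd12 _ _ E) /= ?orbF /parent_rel /=; case: (par1 a).
  by case: (nd2 y) => //= a; rewrite /parent_rel /=; case: (par2 a).
- have [-> ->] := ndB y yB; case E: (nd1 x) => [a|] /=.
    by rewrite ?(nd12 _ _ E) /= ?orbF /parent_rel /=; case: (par1 a).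
  by case: (nd2 x) => //= a; rewrite /parent_rel /=; case: (par2 a).
case Ex: (nd1 x) => [a|] /=; case Ey: (nd1 y) => [b|] /=; rewrite ?orbF //.
- rewrite (nd12 _ _ Ex) /= ?orbF /parent_rel /=.
  congr (_ || (_ || _)); first by case: (par1 a).
  by case: (par1 b).
- rewrite (nd12 _ _ Ex); case: (nd2 y) => [b|] //=.
  by rewrite /parent_rel /=; case: (par1 a) => [?|]; case: (par2 b).
- rewrite (nd12 _ _ Ey); case: (nd2 x) => [a|] //=.
  by rewrite /parent_rel /=; case: (par2 a) => [?|]; case: (par1 b).
case: (nd2 x) => [a|] //; case: (nd2 y) => [b|] //=.
rewrite /parent_rel /=; congr (_ || (_ || _)); first by case: (par2 a).
by case: (par2 b).
Qed.

(** The leaf root is the tree of blocks with each vertex x attached as a leaf to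
    its block.  With at least two vertices, no block is itself a leaf. *)
Lemma tree_leaf_power B E :
  blowup_tree [set: V] B E -> leaf_power 3 (pair_rel E).
Proof.
move=> T; have [r rB] : exists r, r \in B.
  by case: T => ? [? [/set0Pn ? _ _ _]].
have [V1|V1] := eqVneq #|V| 1; first by left.
have [s nsr] : exists s, s != r.
  case: (pickP (predC1 r)) => [s nsr|none]; first by exists s.
  case/negP: V1; apply/fintype1P; exists r => x; apply/eqP.
  by have /negbFE := none x.
have [N [par [rk [nd0 H]]]] := forest_nodes (blowup_tree_forest T).
have [nd ndE] : {nd : V -> N & forall x, nd0 x = Some (nd x)}.
  apply: (@choice _ _ (fun x a => nd0 x = Some a)) => x.
  have := ns_support H x; rewrite inE.
  by case: (nd0 x) => // a _; exists a.
have onto a : exists x, nd x = a.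
  by have [x] := ns_onto H a; rewrite ndE => -[<-]; exists x.
have rootE x : (x \in B) = (par (nd x) == None).
  by rewrite (ns_roots H) ndE.
have edgeE x y : x != y ->
    ((x, y) \in E) = (nd x == nd y) || parent_rel par (nd x) (nd y).
  by move=> nxy; rewrite (ns_pairs H) !ndE nxy.
have root1 a : par a = None -> a = nd r.
  have [x <-] := onto a; move=> px.
  have xB : x \in B by rewrite rootE px.
  have [->//|nxr] := eqVneq x r.
  have := blowup_tree_clique T xB rB nxr; rewrite edgeE // /parent_rel px.
  by move: rB; rewrite rootE => /eqP->; rewrite orbF => /eqP.
pose W : finType := (V + N)%type.
pose parW (w : W) : option W := match w with
  | inl x => Some (inr (nd x))
  | inr a => omap inr (par a)
  end.
pose rkW (w : W) := match w with inl x => (rk (nd x)).+1 | inr a => rk a end.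
pose t := parent_rel parW.
have tsym : symmetric t := @parent_rel_sym _ parW.
have treeW : is_tree t.
  apply: (@parent_tree _ parW rkW (inr (nd r))) => [[x|a] w|/=|[x|a] //=].
  - by case=> <-.
  - by rewrite /=; case Ep: (par a) => [b|] // [<-]; apply: (ns_ranked H).
  - by move: rB; rewrite rootE => /eqP->.
  - by case Ep: (par a) => // _; rewrite (root1 a Ep).
have [_ _ [_ tconn] _] := treeW.
have t_leaf x : t (inl x) =1 pred1 (inr (nd x)).
  move=> w; rewrite /t /parent_rel /= orbC.
  have -> : parW w == Some (inl x) = false.
    by case: w => [y|a] //=; case: (par a).
  by rewrite /= eq_sym.
right; exists W, t, inl; split=> //.
- by move=> x y [].
- move=> w; split=> [|[x ->]]; last first.
    apply/eqP/eqP/cards1P; exists (inr (nd x)); apply/setP => w'.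
    by rewrite !inE t_leaf.
  case: w => [x|a]; first by exists x.
  case/cards1P=> w' /setP nbr; exfalso.
  have [x xa] := onto a.
  have nbr_a w : t (inr a) w = (w == inl x).
    have := nbr w; rewrite !inE => ->.
    by have := nbr (inl x); rewrite !inE tsym t_leaf /= xa eqxx => /esym/eqP->.
  have cl : closed t (pred2 (inl x) (inr a) : pred W).
    apply: intro_closed => [|w1 w2]; first exact: sym_connect_sym.
    move=> t12; rewrite !inE => /orP[] /eqP ew; move: t12; rewrite ew.
      by rewrite t_leaf /= xa => ->; rewrite orbT.
    by rewrite nbr_a => ->.
  have all_x y : y = x.
    have := closed_connect cl (tconn (inl x) (inl y)).
    by rewrite !inE eqxx /= orbF => /esym/eqP[].
  by case/negP: nsr; rewrite (all_x s) (all_x r).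
move=> x y nxy.
rewrite (leaf_dist_le3 tsym _ _ (t_leaf x) (t_leaf y)) //.
rewrite /pair_rel edgeE // /t /parent_rel /=.
congr (_ || (_ || _)); first by case: (par (nd x)).
by case: (par (nd y)).
Qed.

(** The leaf root is rooted at the neighbour of the leaf r, so that r lies in the
    root block.  The neighbours of the leaves induce a subforest of the leaf
    root, which is a single tree because E is connected. *)
Lemma leaf_power_tree E (r : V) :
    (forall x y, (x, y) \in E -> (y, x) \in E) -> (forall x, (x, x) \notin E) ->
    (forall x y, connect (pair_rel E) x y) -> leaf_power 3 (pair_rel E) ->
  exists2 B : {set V}, r \in B & blowup_tree [set: V] B E.
Proof.
move=> Esym Eirr Econ [V1|[W [t [f [treeW finj leafP Edist]]]]].
  have /fintype1P[x0 Vx] : #|V| == 1 by rewrite V1.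
  have E0 : E = complete_pairs [set: V].
    apply/setP => -[x y]; rewrite !inE /= (Vx x) (Vx y) eqxx /=.
    exact/negbTE.
  exists [set: V]; first by rewrite inE.
  rewrite E0; apply: complete_blowup_tree => //.
  by apply/set0Pn; exists r; rewrite inE.
have [tsym _ [_ tconn] _] := treeW.
have [nd ndP] : {nd : V -> W & forall x, t (f x) =1 pred1 (nd x)}.
  apply: (@choice _ _ (fun x a => t (f x) =1 pred1 a)) => x.
  have /leafP/cards1P[w /setP tw] : exists y, f x = f y by exists x.
  by exists w => w'; have := tw w'; rewrite !inE.
have [par [rk [rkP par0 tE]]] := tree_parent (nd r) treeW.
pose S : {set W} := [set nd x | x : V].
have ndS x : nd x \in S by apply: imset_f.
have onS a : a \in S -> exists x, nd x = a by case/imsetP=> x _ ->; exists x.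
have := nodes_forest rkP onS.
have -> : nodes_support nd S = [set: V] by apply/setP => x; rewrite !inE ndS.
have -> : nodes_pairs par nd S = E.
  apply/setP => -[x y]; rewrite inE /= !ndS /=.
  have [->|nxy] /= := eqVneq x y; first exact/esym/negbTE.
  rewrite -tE -[RHS]/(pair_rel E x y) Edist //.
  rewrite (leaf_dist_le3 tsym _ _ (ndP x) (ndP y)) //.
  by apply: contra nxy => /eqP/finj->.
move=> F.
have rM : r \in nodes_roots par nd S.
  by rewrite inE ndS /parent_in par0.
have [D [B [E1 [M2 [E2 [T rD _ F2 [eM eE]]]]]]] := blowup_forest_pick F (in_setT r).
have DT : D = [set: V].
  apply/setP => x; rewrite inE.
  have c := Econ r x; rewrite eE in c.
  rewrite -(pair_connect_closed _ _ c) //.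
    by have [] := blowup_forest_sub (blowup_tree_forest T).
  by have [_] := blowup_forest_sub F2; rewrite setTD.
rewrite DT setDv in F2 T.
have [+ +] := blowup_forest_sub F2; rewrite subset0 => /eqP M20.
have -> : setX set0 set0 = set0 :> {set V * V}.
  by apply/setP => p; rewrite !inE.
rewrite subset0 => /eqP E20.
by exists B; [move: rM; rewrite eM M20 setU0 | rewrite eE E20 setU0].
Qed.
End LeafPowers.

(** * Counting the graphs *)

Section GraphCount.
Variable V : finType.

(** F is the set of ordered adjacent pairs of a simple connected 3-leaf power
    graph on V. *)
Definition connected_3leaf_power_pairs (F : {set V * V}) : Prop :=
  [/\ forall x y, (x, y) \in F -> (y, x) \in F, forall x, (x, x) \notin F,
      connected_graph (pair_rel F) & leaf_power 3 (pair_rel F)].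

Lemma connected_3leaf_powerE (r : V) (F : {set V * V}) :
  connected_3leaf_power_pairs F <->
  exists2 B : {set V}, r \in B & blowup_tree [set: V] B F.
Proof.
split=> [[Fsym Firr [_ Fcon]]|[B rB T]]; first exact: leaf_power_tree.
have [Fsym Firr] := blowup_forest_sym (blowup_tree_forest T).
split=> //; last exact: tree_leaf_power T.
split; first by apply/card_gt0P; exists r.
by move=> x y; apply: blowup_tree_connect T _ _; rewrite inE.
Qed.

(** The set A below is the complement of the block of r. *)
Lemma counted_connected_3leaf_power_pairs (r : V) :
  counted connected_3leaf_power_pairs (graph_num #|V|).
Proof.
pose K := complete_pairs [set: V].
pose Q (A : {set V}) (F : {set V * V}) := blowup_tree [set: V] (~: A) F /\ F <> K.
have rA A : A \in enum (powerset [set~ r]) -> r \in ~: A.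
  by rewrite mem_enum inE subsetC => /subsetP; apply; rewrite !inE eqxx.
have cV : #|[set~ r]|.+1 = #|V|.
  by rewrite cardsC1 prednK //; apply/card_gt0P; exists r.
rewrite /graph_num -cV -(sum_subset [set~ r] (fun j => (forest_num j).-1)) -add1n.
apply: counted_ext (counted_disjU (P := fun F => F = K) _ _
  (counted_bigU (Q := Q) _ _ _)).
- move=> F; rewrite (connected_3leaf_powerE r); split.
    case=> [->|[A /rA rA' [T _]]]; last by exists (~: A).
    exists [set: V]; first by rewrite inE.
    by apply: complete_blowup_tree => //; apply/set0Pn; exists r; rewrite inE.
  case=> B rB T; have [->|FK] := pselect (F = K); [by left|right].
  exists (~: B); last by rewrite /Q setCK.
  by rewrite mem_enum inE setCS sub1set.
- by move=> F -> [A _ [_]].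
- by apply: (counted_one (x0 := K)).
- exact: enum_uniq.
- move=> A /rA rA'.
  have B0 : ~: A != set0 by apply/set0Pn; exists r.
  apply: counted_neq; first by apply: complete_blowup_tree; rewrite ?subsetT.
  have := counted_blowup_tree_at B0 (subsetT _) (counted_blowup_forest _).
  by rewrite setTD setCK.
- move=> A A' AP A'P F [T FK] [T' _]; apply: setC_inj.
  exact: blowup_tree_block_uniq T T' FK (rA _ AP) (rA _ A'P).
Qed.

(** The set of unordered edges of a set of ordered pairs. *)
Definition pairs_edges (F : {set V * V}) : {set {set V}} :=
  [set [set p.1; p.2] | p in F].

Lemma edge_rel_pairs (F : {set V * V}) :
    (forall x y, (x, y) \in F -> (y, x) \in F) ->
  edge_rel (pairs_edges F) = pair_rel F.
Proof.
move=> Fsym; apply/funext => x; apply/funext => y; apply/imsetP/idP.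
  case=> -[a b] abF /= /setP e.
  have := e x; have := e y; have := e a; have := e b.
  rewrite !inE !eqxx !orbT /= => /orP eb /orP ea /esym/orP ey /esym/orP ex.
  case: ex ey ea eb => /eqP ex [] /eqP ey.
  - by move=> _ [] /eqP eb; rewrite /pair_rel ex ey ?eb // -?eb -?ex -?ey //;
      move: abF; rewrite eb ?ex ?ey.
  - by rewrite /pair_rel ex ey.
  - by rewrite /pair_rel ex ey => _ _; apply: Fsym.
  - by move=> [] /eqP ea _; rewrite /pair_rel ex ey; move: abF; rewrite ea ?ex ?ey.
by move=> xyF; exists (x, y).
Qed.

Lemma counted_simple_edges (r : V) :
  counted (fun E : {set {set V}} => simple_edges E /\
      (connected_graph (edge_rel E) /\ leaf_power 3 (edge_rel E)))
    (graph_num #|V|).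
Proof.
apply: counted_ext (counted_image (f := pairs_edges) _
  (counted_connected_3leaf_power_pairs r)) => [E|F F' [Fsym _ _ _] [Fsym' _ _ _] e].
  split=> [[F [Fsym Firr Fcon Flp] ->]|[/subsetP sE [Econ Elp]]].
    rewrite edge_rel_pairs //; split=> //.
    apply/subsetP => _ /imsetP[[x y] xyF ->]; rewrite inE cards2 /=.
    have [exy|//] := eqVneq x y.
    by move: (Firr x); rewrite {2}exy xyF.
  pose F := [set p : V * V | [set p.1; p.2] \in E].
  have FE : pair_rel F = edge_rel E.
    by apply/funext => x; apply/funext => y; rewrite /pair_rel inE.
  exists F; first split; rewrite ?FE //.
  - by move=> x y; rewrite !inE setUC.
  - move=> x; rewrite inE /= setUid; apply/negP => /sE.
    by rewrite inE cards1.
  apply/setP => e; apply/idP/imsetP => [eE|[[x y]]]; last by rewrite inE => ? ->.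
  have := sE _ eE; rewrite inE => /cards2P[x [y [_ exy]]].
  by exists (x, y); rewrite ?inE -?exy.
apply/setP => -[x y].
by rewrite -[LHS]/(pair_rel F x y) -[RHS]/(pair_rel F' x y) -!edge_rel_pairs // e.
Qed.
End GraphCount.

Lemma num_connected_3leaf_powerE n : 0 < n ->
  num_connected_3leaf_power n = graph_num n.
Proof.
case: n => // n _; rewrite -{2}[n.+1]card_ord; apply: counted_card.
apply: counted_ext (counted_simple_edges (@ord0 n)) => E; rewrite inE.
split=> [[sE cE]|/andP[sE /asboolP]//].
by apply/andP; split=> //; apply/asboolP.
Qed.

(** * The generating function and the values *)

From mathcomp Require Import classical_sets cardinality.

Lemma cl_count_counted (A : lclass) n m :
  class_counted A [fset i in iota 1 n]%fset m -> cl_count A n = m.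
Proof.
case=> s [us sP <-]; rewrite /cl_count.
have -> : [set x | labels x = [fset i in iota 1 n]%fset]%classic =
    [set` [fset x in s]%fset]%classic.
  by apply/seteqP; split=> x /= => [/sP|]; rewrite ?in_fset => // /sP.
by rewrite set_fsetK card_fseq undup_id.
Qed.

Theorem corollary3
  (LP SC SX L Lp Kp : lclass)
  (LP_def : (LP ~= Lp * (SC + SX) + Kp)%L)
  (SC_def : (SC ~= Set_ge 2 (L + SX))%L)
  (SX_def : (SX ~= L * Set_ge 1 (L + SX))%L)
  (L_def : (L ~= 'Z + Set_ge 2 'Z)%L)
  (Lp_def : (Lp ~= 'Zp + 'Zp * Set_ge 1 'Z)%L)
  (Kp_def : (Kp ~= 'Zp * Set_ge 2 'Z)%L) :
  (forall n : nat, (3 <= n)%N ->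
     ((num_connected_3leaf_power n)%:R = (n.-1)`!%:R * egf LP n :> rat)%R) /\
  [seq num_connected_3leaf_power n | n <- iota 1 12] =
  [seq nat_of_bin m | m <-
     [:: 1; 1; 4; 35; 361; 4482; 68027; 1238841; 26416474; 646139853;
         17837851021; 548713086352]%num].
Proof.
split=> [n n3|]; last first.
  rewrite -graph_num_values; apply/eq_in_map => n; rewrite mem_iota => /andP[n0 _].
  exact: num_connected_3leaf_powerE.
have n0 : 0 < n by apply: leq_trans n3.
rewrite num_connected_3leaf_powerE // /egf.
have cn : #|` [fset i in iota 1 n]%fset| = n.
  by rewrite card_fseq undup_id ?iota_uniq // size_iota.
have := @counted_LP LP SC SX L Lp Kp LP_def SC_def SX_def L_def Lp_def Kp_def
  [fset i in iota 1 n]%fset.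
rewrite cn => /(_ n3) /cl_count_counted ->.
have fn0 : ((n`!)%:R != 0 :> rat)%R by rewrite Num.Theory.pnatr_eq0 -lt0n fact_gt0.
rewrite GRing.mulrA -GRing.natrM.
have -> : ((n.-1)`! * (n * graph_num n) = graph_num n * n`!)%N.
  by rewrite -[in RHS](prednK n0) factS (prednK n0) mulnA [RHS]mulnC [(_ * n)%N]mulnC.
by rewrite GRing.natrM GRing.mulfK.
Qed.
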